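(* For any integers $r\ge1$ and $d\ge2$, the quantity $N^d_r(m)$ grows at least as fast as $m^{d+1}$ as $m\to\infty$. More precisely, $$\liminf_{m\to\infty}\frac{N^d_r(m)}{m^{d+1}}\ \ge\ \frac{4}{\bigl(2^{d+1}+d-2\bigr)^{d+1}}.$$
   Context: For a polynomial vector field $\mathbf{P}=(P_1,\dots,P_{d+1}):\mathbb{R}^{d+1}\to\mathbb{R}^{d+1}$ let $\deg(\mathbf{P})=\max_i\deg(P_i)$ and let $\tau^d_r(\mathbf{P})$ be the number of $r$-normally hyperbolic invariant $d$-tori of $\dot{\mathbf{x}}=\mathbf{P}(\mathbf{x})$. For $m\in\mathbb{N}$, $$N^d_r(m)=\sup\{\tau^d_r(\mathbf{P}):\deg(\mathbf{P})\le m\}\in\mathbb{N}\cup\{\infty\}.$$ A $d$-torus is the image of an embedding of $(\mathbb{R}/\mathbb{Z})^d$. Normal hyperbolicity: let $\phi_t$ be the flow of $\dot x=F(x)$ in $\mathbb{R}^{d+1}$ and let $M$ be a compact connected invariant manifold of class $C^1$. Let $N$ be the normal bundle of $M$ with respect to the standard metric and $\Pi$ the orthogonal projection of $T\mathbb{R}^{d+1}|_M$ onto $N$. For $t\in\mathbb{R}$ and $p\in M$ put $$A_t(p)=D(\phi_{-t}|_M)(p):T_pM\to T_{\phi_{-t}(p)}M,\qquad B_t(p)=\Pi\cdot D\phi_t(\phi_{-t}(p))|_N:N_{\phi_{-t}(p)}\to N_p.$$ $M$ is attracting $r$-normally hyperbolic (in the absolute sense) if there are $K_A,K_B>1$ and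 $\rho_M,\rho_N>0$ with $\|A_t(p)\|\le K_Ae^{\rho_M|t|}$ for all $t\in\mathbb{R}$, $p\in M$; $\|B_t(p)\|\le K_Be^{-\rho_Nt}$ for all $t\ge0$, $p\in M$; and $\rho_N>r\,\rho_M$. A codimension-$1$ invariant torus is $r$-normally hyperbolic if it is attracting $r$-normally hyperbolic either for the system $\dot x=F(x)$ or for the time-reversed system $\dot x=-F(x)$. *)

(* Defs.v *)
From HB Require Import structures.
From mathcomp Require Import all_boot all_order all_algebra.
From mathcomp Require Import all_classical all_reals all_analysis.
(* The notations of mpoly clash with those of analysis. *)
From mathcomp Require Import -(notations) mpoly.
Set Implicit Arguments.
Unset Strict Implicit.
Unset Printing Implicit Defensive.
Import Order.TTheory GRing.Theory Num.Theory.
Import numFieldNormedType.Exports.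
Local Open Scope classical_set_scope.
Local Open Scope ring_scope.

Section Euclidean.
Variables (R : realType) (n : nat).
Implicit Types (u v : 'rV[R]_n) (V : set 'rV[R]_n).

Definition dot u v : R := \sum_(i < n) u 0 i * v 0 i.

(* The library norm `|v| on row vectors is the sup norm. *)
Definition enorm v : R := Num.sqrt (dot v v).

Definition orth_compl V : set 'rV[R]_n :=
  [set w | forall v, V v -> dot v w = 0].

(* Only meaningful when V is a linear subspace; then w exists and is unique. *)
Definition orth_proj V v : 'rV[R]_n :=
  xget 0 [set w | V w /\ orth_compl V (v - w)].

(* Operator norm of the restriction of L to the subspace V, for the Euclidean
   norm on both sides; extended-real so that no boundedness is presupposed. *)
Definition opnorm_on V (L : 'rV[R]_n -> 'rV[R]_n) : \bar R :=
  ereal_sup [set (enorm (L v))%:E | v in [set v | V v /\ enorm v <= 1]].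

End Euclidean.

Section Flow.
Variables (R : realType) (n : nat) (F : 'rV[R]_n -> 'rV[R]_n).

(* Some solution of x' = F(x) on the closed interval between 0 and t (t may be
   negative) goes from x to y.  The two-sided derivatives at the end points are
   no restriction: for locally Lipschitz F a solution extends past them. *)
Definition flows_to (t : R) (x y : 'rV[R]_n) : Prop :=
  exists gamma : R -> 'rV[R]_n,
    [/\ gamma 0 = x, gamma t = y &
        forall s : R, Num.min 0 t <= s <= Num.max 0 t ->
          is_derive s (1 : R) gamma (F (gamma s))].

(* The flow need not be complete; the value is junk (namely x) where the
   solution through x does not exist up to time t. *)
Definition flow (t : R) (x : 'rV[R]_n) : 'rV[R]_n :=
  xget x [set y | flows_to t x y].

Definition flow_invariant (M : set 'rV[R]_n) : Prop :=
  forall t x, M x -> exists2 y, flows_to t x y & M y.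

End Flow.

Section NormallyHyperbolicTori.
Variables (R : realType) (d n : nat).
Implicit Types (F : 'rV[R]_n -> 'rV[R]_n) (h : 'rV[R]_d -> 'rV[R]_n).

(* A map on (R/Z)^d is a Z^d-periodic map h on R^d.  The first clause gives both
   periodicity and injectivity on the quotient; the last one says that the
   induced map is open onto its image (opens of the torus are the images of the
   opens of R^d), hence a homeomorphism onto it. *)
Definition torus_embedding h : Prop :=
  [/\ forall x y, h x = h y <-> exists k : 'rV[int]_d, y = x + map_mx intr k,
      forall x, differentiable h x,
      continuous (jacobian h),
      forall x, injective ('d h x) &
      forall U : set 'rV[R]_d, open U ->
        exists2 V : set 'rV[R]_n, open V & h @` U = range h `&` V].

Definition tangent_at h (p : 'rV[R]_n) : set 'rV[R]_n :=
  [set v | exists x u, h x = p /\ v = 'd h x u].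

Definition normal_at h (p : 'rV[R]_n) : set 'rV[R]_n :=
  orth_compl (tangent_at h p).

(* M = range h is assumed invariant under F.  Since the flow is differentiable
   on a neighbourhood of M, D(phi_{-t}|_M)(p) is the restriction of the
   differential of phi_{-t} at p to T_p M. *)
Definition attracting_normally_hyperbolic (r : nat) F h : Prop :=
  let A t p := 'd (flow F (- t)) p in
  let B t p v :=
    orth_proj (normal_at h p) ('d (flow F t) (flow F (- t) p) v) in
  exists KA KB rhoM rhoN : R,
    [/\ [/\ 1 < KA, 1 < KB, 0 < rhoM & 0 < rhoN],
        forall t p, range h p ->
          (opnorm_on (tangent_at h p) (A t p)
             <= (KA * expR (rhoM * `|t|))%:E)%E,
        forall t p, 0 <= t -> range h p ->
          (opnorm_on (normal_at h (flow F (- t) p)) (B t p)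
             <= (KB * expR (- rhoN * t))%:E)%E &
        r%:R * rhoM < rhoN].

(* Tori are counted as subsets M; the embedding is existentially quantified. *)
Definition normally_hyperbolic_torus (r : nat) F (M : set 'rV[R]_n) : Prop :=
  exists h,
    [/\ torus_embedding h, range h = M, flow_invariant F M &
        attracting_normally_hyperbolic r F h \/
        attracting_normally_hyperbolic r (fun x => - F x) h].

End NormallyHyperbolicTori.

Section Polynomial.
Variables (R : realType) (n : nat).
Implicit Types P : 'I_n -> mpoly n R.

Definition poly_field P (x : 'rV[R]_n) : 'rV[R]_n :=
  \row_i meval (fun j => x 0 j) (P i).

(* msize is 1 + total degree; the zero polynomial gets degree 0. *)
Definition field_degree P : nat := \max_(i < n) (msize (P i)).-1.

End Polynomial.

Definition num_tori (R : realType) (r d : nat)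
    (P : 'I_d.+1 -> mpoly d.+1 R) : \bar R :=
  counting [set M | normally_hyperbolic_torus d r (poly_field P) M].

Definition max_num_tori (R : realType) (r d m : nat) : \bar R :=
  ereal_sup [set num_tori r P | P in
    [set P : 'I_d.+1 -> mpoly d.+1 R | (field_degree P <= m)%N]].

(* Main.v *)
(** Put [y_j = p_j(x_j)], where [p_j] is a product of [n_j] distinct linear
    factors, [H_0 = y_0], [H_(j+1) = H_j^2 + y_(j+1)^2 - e_j] and [G = H_d].  When
    the [e_j] decrease fast enough, the part of [G = 0] near [y = 0] is a [d]-torus
    on which the [y_j] are so small that [x_j] can be taken near any of the roots
    of [p_j]; this gives [n_0 ... n_d] disjoint tori in the [x]-space.

    Such a torus is normally hyperbolic for every [r] as soon as
    [grad G . F = K G] with [K] of constant sign on it and the flow on the torus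
    separates points at most subexponentially.

    For [d >= 3] take [n_j = N] for [j < d], [n_d = 4 N] and [F = - G grad G], of
    degree at most [2^(d+1) N], with [4 N^(d+1)] tori of equilibria.  For [d = 2]
    the degree of this field would only allow [n_2 = 2 N], which is not enough;
    with [n = (N, N, 2 N)] a field of degree [6 N] that rotates its [2 N^3] tori
    gives [2 / 6^3 > 4 / 8^3]. *)

Require Import Defs.
From HB Require Import structures.
From mathcomp Require Import all_boot all_order all_algebra.
From mathcomp Require Import all_classical all_reals all_analysis.
From mathcomp Require Import -(notations) mpoly.
From mathcomp Require Import ring lra zify.
Set Implicit Arguments.
Unset Strict Implicit.
Unset Printing Implicit Defensive.
Import Order.TTheory GRing.Theory Num.Theory.
Import numFieldNormedType.Exports.
Local Open Scope classical_set_scope.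
Local Open Scope ring_scope.

(** * Euclidean norm and gradients *)

(** Normal contraction is obtained from increments, not from a linearised equation. Where
    [K <= - 2 kap] on the torus, [G] decays at rate [kap] along nearby orbits, and the component
    along [grad G] of the differential of the flow is a limit of quotients of values of [G]. Since
    distances inside the torus grow slower than any exponential, [rhoM] can be chosen with
    [r rhoM < kap], whatever [r] is.

    Solving [H_d = 0] downwards, [(H_i, y_(i+1))] lies on the circle of radius
    [sqrt (e_i + H_(i+1))], which adds one angle per step; the fast decrease of [e] keeps the
    radicands positive.

    The bound [deg H_i <= 2^i N] asks for [n_(i+1) <= 2^i N], so [n_d = 4 N] is admissible once
    [2^(d-1) >= 4].

    In dimension three, lowering the degree from [8 N] to [6 N] costs the definite rate:
    [grad G . F = 2 z^2 D_2 G] degenerates where [z = y_2] vanishes. The rotation carries every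
    point of the torus across this set, so the rate is definite on average along orbits; multiplying
    [G] by [exp (lam u z)], with [u = H_1], adds the derivative of [lam u z] along the flow to the
    rate and makes it definite at each point. *)

Lemma diff_nondifferentiable (K : numFieldType) (V W : normedModType K)
    (f : V -> W) x :
  ~ differentiable f x -> forall v, 'd f x v = 0.
Proof.
move=> nd v; rewrite /diff.
(* The differential is a chosen candidate, with the zero map as default; a genuine candidate would
   make [f] differentiable. *)
case: xgetP => [df dfE [dfc dfx]|_]; last by [].
exfalso; apply: nd; apply/diffP.
rewrite -[X in continuous X]/(GRing.Linear.sort ('d f x)).
by rewrite /diff -dfE; split.
Qed.

Section Dot.
Variables (R : realType) (n : nat).
Implicit Types (u v w : 'rV[R]_n).

Lemma dotC u v : dot u v = dot v u.
Proof. by apply: eq_bigr => i _; rewrite mulrC. Qed.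

Lemma dotDr u v w : dot u (v + w) = dot u v + dot u w.
Proof. by rewrite /dot -big_split; apply: eq_bigr => i _; rewrite mxE mulrDr. Qed.

Lemma dotZr (a : R) u v : dot u (a *: v) = a * dot u v.
Proof.
by rewrite /dot mulr_sumr; apply: eq_bigr => i _; rewrite mxE mulrCA.
Qed.

Lemma dotDl u v w : dot (u + v) w = dot u w + dot v w.
Proof. by rewrite dotC dotDr !(dotC w). Qed.

Lemma dotZl (a : R) u v : dot (a *: u) v = a * dot u v.
Proof. by rewrite dotC dotZr dotC. Qed.

Lemma dotNr u v : dot u (- v) = - dot u v.
Proof. by rewrite -scaleN1r dotZr mulN1r. Qed.

Lemma dotBr u v w : dot u (v - w) = dot u v - dot u w.
Proof. by rewrite dotDr dotNr. Qed.

Lemma dot0l u : dot 0 u = 0.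
Proof. by rewrite -(scale0r 0) dotZl mul0r. Qed.

Lemma dot_ge0 u : 0 <= dot u u.
Proof. by apply: sumr_ge0 => i _; rewrite -expr2 sqr_ge0. Qed.

Lemma dot_delta u i : dot u (delta_mx 0 i) = u 0 i.
Proof.
rewrite /dot (bigD1 i)//= big1 => [|j ji].
  by rewrite mxE !eqxx mulr1 addr0.
by rewrite mxE (negbTE ji) andbF mulr0.
Qed.

Lemma dot_eq0 u : (dot u u == 0) = (u == 0).
Proof.
apply/eqP/eqP => [u0|->]; last exact: dot0l.
apply/rowP => i; rewrite mxE.
have := psumr_eq0P (fun i _ => sqr_ge0 (u 0 i)) u0 (i := i) isT.
by move/eqP; rewrite sqrf_eq0 => /eqP.
Qed.

Lemma dot_gt0 u : u != 0 -> 0 < dot u u.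
Proof. by move=> u0; rewrite lt_neqAle dot_ge0 andbT eq_sym dot_eq0. Qed.

Lemma dot_mulmx u v : (u *m v^T) 0 0 = dot u v.
Proof. by rewrite mxE; apply: eq_bigr => i _; rewrite mxE. Qed.

Lemma enorm_ge0 u : 0 <= enorm u. Proof. exact: sqrtr_ge0. Qed.

Lemma enorm_sqr u : enorm u ^+ 2 = dot u u.
Proof. by rewrite sqr_sqrtr ?dot_ge0. Qed.

Lemma enorm_gt0 u : u != 0 -> 0 < enorm u.
Proof. by move=> u0; rewrite sqrtr_gt0 dot_gt0. Qed.

Lemma enorm0 : enorm (0 : 'rV[R]_n) = 0.
Proof. by rewrite /enorm dot0l sqrtr0. Qed.

Lemma enormZ (a : R) u : enorm (a *: u) = `|a| * enorm u.
Proof.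
by rewrite /enorm dotZl dotZr mulrA -expr2 sqrtrM ?sqr_ge0// sqrtr_sqr.
Qed.

Lemma cauchy_schwarz u v : `|dot u v| <= enorm u * enorm v.
Proof.
have [->|u0] := eqVneq u 0; first by rewrite dot0l normr0 mulr_ge0 ?enorm_ge0.
rewrite -(ler_pXn2r (n := 2))// ?nnegrE ?mulr_ge0 ?enorm_ge0//.
rewrite exprMn !enorm_sqr real_normK ?num_real//.
have u1 := dot_gt0 u0.
have := dot_ge0 (dot u u *: v - dot u v *: u).
rewrite dotBr !(dotC (_ - _)) !dotBr !dotZl !dotZr (dotC v u) => H.
rewrite -(ler_pM2l u1) -subr_ge0.
by apply: le_trans H _; rewrite le_eqVlt; apply/orP; left; apply/eqP; ring.
Qed.

Lemma coord_le_norm u i : `|u 0 i| <= `|u|.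
Proof.
by rewrite /Num.Def.normr/= mx_normrE; exact: (le_bigmax _ _ (ord0, i)).
Qed.

Lemma norm_le_coord u (e : R) : 0 <= e -> (forall i, `|u 0 i| <= e) -> `|u| <= e.
Proof.
move=> e0 ue; rewrite /Num.Def.normr/= mx_normrE; apply: bigmax_le => //.
by case=> i j _ /=; rewrite (ord1 i).
Qed.

Lemma norm_le_enorm u : `|u| <= enorm u.
Proof.
apply: norm_le_coord => [|i]; first exact: enorm_ge0.
rewrite -(sqrtr_sqr (u 0 i)) ler_wsqrtr// /dot (bigD1 i)//= -expr2 lerDl.
by apply: sumr_ge0 => j _; rewrite -expr2 sqr_ge0.
Qed.

Lemma enorm_le_norm u : enorm u <= n%:R * `|u|.
Proof.
have [n0|n0] := posnP n.
  rewrite (_ : u = 0) ?enorm0 ?mulr_ge0//.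
  by apply/rowP => -[i i_n]; exfalso; move: i_n; rewrite n0.
rewrite -(ler_pXn2r (n := 2))// ?nnegrE ?enorm_ge0 ?mulr_ge0//.
rewrite enorm_sqr; apply: (@le_trans _ _ (\sum_(i < n) `|u| ^+ 2)).
  apply: ler_sum => i _; rewrite -expr2 -real_normK ?num_real//.
  by rewrite lerXn2r ?nnegrE ?coord_le_norm.
rewrite sumr_const card_ord -[leLHS]mulr_natl exprMn ler_wpM2r ?sqr_ge0//.
by rewrite -natrX ler_nat expnS expn1 leq_pmulr.
Qed.

End Dot.

Section C1Functions.
Variables (R : realType) (n : nat).
Implicit Types (f : 'rV[R]_n -> R) (g : 'rV[R]_n -> 'rV[R]_n).

Lemma row_continuous (T : topologicalType) m (g : T -> 'rV[R]_m) :
  (forall i, continuous (fun x => g x 0 i)) -> continuous g.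
Proof.
move=> gc x; apply/cvgrPdist_le => e e0; near=> y.
apply: norm_le_coord => [|i]; first exact: ltW.
rewrite !mxE; move: i; near: y; apply: filter_forall => i.
by have /cvgrPdist_le/(_ e e0) := gc i x.
Unshelve. all: by end_near. Qed.

Lemma continuous_coord m i : continuous (fun x : 'rV[R]_m => x 0 i).
Proof. exact: coord_continuous. Qed.

(** The gradient is explicit data because the identity [grad G . F = K G] is a statement about
    it. *)
Definition C1 f g := (forall x, is_diff x f (dot (g x))) /\ continuous g.

Lemma C1_differentiable f g x : C1 f g -> differentiable f x.
Proof. by move=> [/(_ x)[]]. Qed.

Lemma C1_diff f g x v : C1 f g -> 'd f x v = dot (g x) v.
Proof. by move=> [/(_ x)[_ ->]]. Qed.

Lemma C1_continuous f g : C1 f g -> continuous f.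
Proof. by move=> fg x; exact/differentiable_continuous/C1_differentiable/fg. Qed.

Lemma C1_cst a : C1 (cst a) (cst 0).
Proof.
split=> [x|]; last exact: cst_continuous.
rewrite (_ : dot (cst 0 x) = 0 :> ('rV[R]_n -> R)); first exact: is_diff_cst.
by apply/funext => v; rewrite dot0l.
Qed.

Lemma C1_coord i : C1 (fun x => x 0 i) (cst (delta_mx 0 i)).
Proof.
split=> [x|]; last exact: cst_continuous.
have @l : {linear 'rV[R]_n -> R}.
  by exists (fun x : 'rV[R]_n => x 0 i); do 2![eexists]; do ?[constructor];
     rewrite ?mxE// => ? *; rewrite ?mxE//; move=> ?; rewrite !mxE.
have lc : continuous l by exact: continuous_coord.
split; first exact: differentiable_coord.
rewrite (_ : (fun _ => _) = l)// diff_lin//.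
by apply/funext => v; rewrite dotC dot_delta.
Qed.

Lemma C1_add f1 f2 g1 g2 : C1 f1 g1 -> C1 f2 g2 ->
  C1 (fun x => f1 x + f2 x) (fun x => g1 x + g2 x).
Proof.
move=> [d1 c1] [d2 c2]; split=> [x|x]; last exact: continuousD (c1 x) (c2 x).
rewrite (_ : dot _ = dot (g1 x) + dot (g2 x)); first exact: is_diffD.
by apply/funext => v; rewrite dotDl.
Qed.

Lemma C1_mul f1 f2 g1 g2 : C1 f1 g1 -> C1 f2 g2 ->
  C1 (fun x => f1 x * f2 x) (fun x => f1 x *: g2 x + f2 x *: g1 x).
Proof.
move=> fg1 fg2; have [d1 c1] := fg1; have [d2 c2] := fg2; split=> [x|x].
  rewrite (_ : dot _ = f1 x *: dot (g2 x) + f2 x *: dot (g1 x)).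
    exact: is_diffM.
  by apply/funext => v; rewrite dotDl !dotZl.
exact: continuousD (cvgZ (C1_continuous fg1 (x := x)) (c2 x))
  (cvgZ (C1_continuous fg2 (x := x)) (c1 x)).
Qed.

Lemma C1_comp f g (phi dphi : R -> R) : C1 f g ->
  (forall x, is_derive (f x) 1 phi (dphi (f x))) ->
  continuous (fun x => dphi (f x)) ->
  C1 (fun x => phi (f x)) (fun x => dphi (f x) *: g x).
Proof.
move=> fg dph cph; have [df cg] := fg; split=> [x|x]; last first.
  exact: cvgZ (cph x) (cg x).
have ph : is_diff (f x) phi (fun h => h *: dphi (f x)).
  have dp : derivable phi (f x) 1 by have [] := dph x.
  split; first exact/derivable1_diffP.
  by rewrite deriv1E// derive1E; have [_ ->] := dph x.
rewrite (_ : dot _ = (fun h => h *: dphi (f x)) \o dot (g x)).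
  exact: is_diff_comp.
by apply/funext => v; rewrite dotZl /= mulrC.
Qed.

Lemma C1_along f g (c : R -> 'rV[R]_n) (s : R) (c' : 'rV[R]_n) : C1 f g ->
  is_derive s (1 : R) c c' ->
  is_derive s (1 : R) (fun s => f (c s)) (dot (g (c s)) c').
Proof.
move=> fg [dc c'E].
have cd : differentiable c s by exact/derivable1_diffP.
have fd := C1_differentiable (c s) fg.
have dfc : differentiable (f \o c) s by exact: differentiable_comp.
split; first exact: diff_derivable.
by rewrite deriveE// (diff_comp cd fd)/= (C1_diff _ _ fg) -deriveE// c'E.
Qed.

End C1Functions.

Section RowDerive.
Variables (R : realType) (n : nat).
Implicit Types (c : R -> 'rV[R]_n).

Lemma is_derive_coord c (s : R) (c' : 'rV[R]_n) i : is_derive s (1 : R) c c' ->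
  is_derive s (1 : R) (fun s => c s 0 i) (c' 0 i).
Proof.
move=> [dc <-]; split; first by have /derivable_mxP := dc.
by rewrite derive_mx// mxE.
Qed.

Lemma is_derive_row c (s : R) (c' : 'rV[R]_n) :
  (forall i, is_derive s (1 : R) (fun s => c s 0 i) (c' 0 i)) ->
  is_derive s (1 : R) c c'.
Proof.
move=> H; have dc : derivable c s 1.
  by apply/derivable_mxP => i j; rewrite (ord1 i); case: (H j).
split=> //; rewrite derive_mx//; apply/rowP => i; rewrite mxE.
by case: (H i).
Qed.

Lemma differentiable_row m (f : 'rV[R]_m -> 'rV[R]_n) x :
  (forall i, differentiable (fun x => f x 0 i) x) -> differentiable f x.
Proof.
move=> df; rewrite (_ : f = \sum_(i < n) (fun x => f x 0 i *: delta_mx 0 i)).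
  apply: differentiable_sum => i.
  exact: (@differentiableZl _ _ _ (fun x => f x 0 i)).
by apply/funext => y; rewrite fct_sumE {1}(row_sum_delta (f y)).
Qed.

Lemma diff_row m (f : 'rV[R]_m -> 'rV[R]_n) x v i :
  differentiable f x -> ('d f x v) 0 i = 'd (fun x => f x 0 i) x v.
Proof.
move=> df; have dc := differentiable_coord (f x) 0 i.
have := diff_comp df dc => /(congr1 (fun k => k v)) /= ->.
by rewrite (C1_diff _ _ (C1_coord R i)) dotC dot_delta.
Qed.

(** The inequality between increments passes to difference quotients and to their limits. It serves
    to bound the differential of a flow of which only increments are under control. *)
Lemma norm_le_derive (V W : normedModType R) (a : R -> V) (b : R -> W) (s c : R) a' b' :
  is_derive s (1 : R) a a' -> is_derive s (1 : R) b b' -> 0 <= c ->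
  (\forall e \near s, `|a e - a s| <= c * `|b e - b s|) ->
  `|a'| <= c * `|b'|.
Proof.
move=> [da <-] [db <-] c0 ab.
have := cvg_norm da; have := cvg_norm db => cb ca.
have {}ca := ca (dnbhs_filter _); have {}cb := cb (dnbhs_filter _).
have cb' := cvgM (cvg_cst c) cb.
have {}cb' := cb' (dnbhs_filter _) (dnbhs_filter _).
apply: (ler_cvg_to ca cb'); near=> h.
rewrite /= !normrZ mulrCA ler_wpM2l//.
near: h; apply: cvg_within.
have hs : (h *: (1 : R) + s) @[h --> (0 : R)] --> s.
  rewrite -[X in _ --> X]add0r -[X in _ --> X + _](scale0r (1 : R)).
  by apply: cvgD; [apply: cvgZr_tmp; exact: cvg_id|exact: cvg_cst].
exact: hs ab.
Unshelve. all: by end_near. Qed.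

End RowDerive.

(** * Mean value inequalities and primitives *)

Section MeanValue.
Variable R : realType.
Implicit Types f g : R -> R.

Lemma derive_continuous (V : normedModType R) (f : R -> V) (s : R) (l : V) :
  is_derive s (1 : R) f l -> {for s, continuous f}.
Proof. by move=> [df _]; exact/differentiable_continuous/derivable1_diffP. Qed.

Lemma derive_within_continuous (V : normedModType R) (f : R -> V) (f' : R -> V)
    (a b : R) :
  (forall s : R, a <= s <= b -> is_derive s (1 : R) f (f' s)) ->
  {within `[a, b], continuous f}.
Proof.
move=> df; apply: derivable_within_continuous => s.
by rewrite in_itv /= => /df[].
Qed.

Lemma derive_ge0_le f f' (a b : R) : a <= b ->
  (forall s : R, a <= s <= b -> is_derive s (1 : R) f (f' s)) ->
  (forall s, a <= s <= b -> 0 <= f' s) -> f a <= f b.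
Proof.
move=> ab df f'0.
have df' x : x \in `]a, b[ -> is_derive x 1 f (f' x).
  by rewrite in_itv /= => /andP[/ltW ? /ltW ?]; apply: df; apply/andP.
have [c + E] := MVT_segment ab df' (derive_within_continuous df).
rewrite in_itv /= => cab; rewrite -subr_ge0 E mulr_ge0 ?f'0//.
by rewrite subr_ge0.
Qed.

(** Both [g - f] and [g + f] have nonnegative derivative. *)
Lemma derive_norm_le f f' g g' (a b : R) : a <= b ->
  (forall s : R, a <= s <= b -> is_derive s (1 : R) f (f' s)) ->
  (forall s : R, a <= s <= b -> is_derive s (1 : R) g (g' s)) ->
  (forall s, a <= s <= b -> `|f' s| <= g' s) -> `|f b - f a| <= g b - g a.
Proof.
move=> ab df dg fg.
have H1 := @derive_ge0_le (fun s => g s - f s) (fun s => g' s - f' s) a b ab.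
have H2 := @derive_ge0_le (fun s => g s + f s) (fun s => g' s + f' s) a b ab.
have {}H1 : g a - f a <= g b - f b.
  apply: H1 => s sab; first by apply: is_deriveB; [exact: dg|exact: df].
  by have := fg s sab; rewrite ler_norml => /andP[_]; rewrite subr_ge0.
have {}H2 : g a + f a <= g b + f b.
  apply: H2 => s sab; first by apply: is_deriveD; [exact: dg|exact: df].
  by have := fg s sab; rewrite ler_norml => /andP[]; rewrite -subr_ge0 opprK addrC.
rewrite ler_norml; lra.
Qed.

Lemma eq_primitive f g h (a b c : R) : a <= c <= b ->
  (forall s : R, a <= s <= b -> is_derive s (1 : R) f (h s)) ->
  (forall s : R, a <= s <= b -> is_derive s (1 : R) g (h s)) ->
  f c = g c -> forall s, a <= s <= b -> f s = g s.
Proof.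
move=> /andP[ac cb] df dg fgc s /andP[as_ sb]; apply/eqP; rewrite -subr_eq0.
rewrite -normr_le0.
have dfg (u v : R) : a <= u -> u <= v -> v <= b ->
    `|f v - g v - (f u - g u)| <= 0.
  move=> au uv vb.
  have := @derive_norm_le (fun s => f s - g s) (fun=> 0) (cst 0) (fun=> 0) u v uv.
  rewrite /= subrr; apply=> w /andP[uw wv].
  - rewrite -(subrr (h w)); apply: is_deriveB; [apply: df|apply: dg];
    by rewrite (le_trans au uw) (le_trans wv vb).
  - by rewrite normr0.
have [cs|/ltW sc] := leP c s.
  by have := dfg c s ac cs sb; rewrite fgc subrr subr0.
by have := dfg s c as_ sc cb; rewrite fgc subrr sub0r normrN.
Qed.

(** An integral from a fixed lower end point is known to be differentiable only to the right of that
    point. The integrals from the points [- N], normalised at [0], agree where they overlap and are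
    glued. *)
Lemma primitive_exists f : continuous f ->
  exists2 A : R -> R, A 0 = 0 & forall s : R, is_derive s (1 : R) A (f s).
Proof.
move=> cf.
pose J (a s : R) := (\int[lebesgue_measure]_(t in [set` `[a, s]]) f t)%R.
have dJ (a s : R) : a < s -> is_derive s (1 : R) (J a) (f s).
  move=> a_s; have s_u : s < s + 1 by rewrite ltrDl.
  have [||Jd Je] := @continuous_FTC1_closed R f a s (s + 1) s_u _ a_s.
  - apply: continuous_compact_integrable; first exact: segment_compact.
    exact: continuous_subspaceT.
  - exact: cf.
  by split; [exact: Jd|rewrite -derive1E; exact: Je].
pose A (N s : R) := J (- N) s - J (- N) 0.
have dA (N s : R) : - N < s -> is_derive s (1 : R) (A N) (f s).
  move=> Ns; rewrite -[f s]subr0; apply: is_deriveB.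
  exact: dJ.
have AE (M N s : R) : 0 < M -> M <= N -> - M < s -> A M s = A N s.
  move=> M0 MN Ms; pose a := Num.min s 0; pose b := Num.max s 0.
  have aM : - M < a by rewrite lt_min Ms oppr_lt0.
  apply: (@eq_primitive (A M) (A N) f a b 0); rewrite /a /b.
  - by rewrite ge_min lexx orbT le_max lexx orbT.
  - by move=> u /andP[au _]; apply: dA; apply: lt_le_trans au.
  - move=> u /andP[au _]; apply: dA; apply: lt_le_trans au.
    by apply: le_lt_trans aM; rewrite lerN2.
  - by rewrite /A !subrr.
  - by rewrite ge_min lexx le_max lexx.
(* The lower end point moves with the argument, but by [AE] the value does not depend on it; near
   [s] the function is [A (|s| + 2)]. *)
exists (fun s => A (`|s| + 1) s); first by rewrite /A subrr.
move=> s; apply: (@near_eq_is_derive _ _ _ (A (`|s| + 2))); last first.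
  by apply: dA; have := ler_norm (- s); rewrite normrN; lra.
near=> u.
have us : `|u - s| < 1.
  by rewrite distrC; near: u; exact: (@nbhsx_ballx _ R s 1 ltr01).
have := ler_norm (- u); have := ler_normD (u - s) s; rewrite subrK normrN => ? ?.
by have := normr_ge0 u; rewrite [RHS](@AE _ (`|s| + 2)) //; lra.
Unshelve. all: by end_near. Qed.

End MeanValue.

(** * Solutions of Lipschitz systems *)

Section Picard.
Variables (R : realType) (n : nat).
Implicit Types (F : 'rV[R]_n -> 'rV[R]_n) (c : R -> 'rV[R]_n).

Lemma row_primitive_exists c : continuous c ->
  exists2 A : R -> 'rV[R]_n, A 0 = 0 & forall s : R, is_derive s (1 : R) A (c s).
Proof.
move=> cc.
have H i : exists2 A : R -> R, A 0 = 0 &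
    forall s : R, is_derive s (1 : R) A (c s 0 i).
  apply: primitive_exists => s.
  by apply: (@continuous_comp _ _ _ c (fun x => x 0 i));
    [exact: cc|exact: continuous_coord].
pose A i := projT1 (cid2 (H i)); exists (fun s => \row_i A i s).
  by apply/rowP => i; rewrite !mxE /A; case: (cid2 _).
move=> s; apply: is_derive_row => i; rewrite /A.
rewrite (_ : (fun s => _) = projT1 (cid2 (H i))).
  by case: (cid2 _) => /= B _ /(_ s).
by apply/funext => u; rewrite mxE.
Qed.

Lemma row_derive_norm_le c (c' : R -> 'rV[R]_n) (g g' : R -> R) (a b : R) :
  a <= b ->
  (forall s : R, a <= s <= b -> is_derive s (1 : R) c (c' s)) ->
  (forall s : R, a <= s <= b -> is_derive s (1 : R) g (g' s)) ->
  (forall s, a <= s <= b -> `|c' s| <= g' s) -> `|c b - c a| <= g b - g a.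
Proof.
move=> ab dc dg cg; apply: norm_le_coord => [|i].
  rewrite subr_ge0; apply: (derive_ge0_le ab dg) => s sab.
  exact: le_trans (normr_ge0 _) (cg s sab).
rewrite !mxE; apply: (@derive_norm_le _ (fun s => c s 0 i) (fun s => c' s 0 i)) dg _.
- exact: ab.
- by move=> s sab; apply: is_derive_coord; exact: dc.
- by move=> s sab; apply: le_trans (coord_le_norm _ _) (cg s sab).
Qed.

(* The weight [expR (2 L |s|)] makes the Picard operator of an [L]-Lipschitz
   field a contraction of factor [1/2] on the whole line. *)
Lemma exp_weight_bound c (c' : R -> 'rV[R]_n) (L C : R) : 0 < L -> 0 <= C ->
  (forall s : R, is_derive s (1 : R) c (c' s)) ->
  (forall s, `|c' s| <= 2 * L * C * expR (2 * L * `|s|)) ->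
  forall s, `|c s - c 0| <= C * expR (2 * L * `|s|).
Proof.
move=> L0 C0 dc cC s.
have dE (k : R) (u : R) :
    is_derive u (1 : R) (fun u => C * expR (k * u)) (k * C * expR (k * u)).
  apply: is_derive_eq; rewrite /GRing.scale /=; ring.
have [s0|/ltW s0] := leP 0 s.
  have := @row_derive_norm_le c c' _ _ 0 s s0 (fun u _ => dc u) (fun u _ => dE (2 * L) u).
  rewrite mulr0 expR0 mulr1 (ger0_norm s0) => H.
  apply: le_trans (H _) _.
    by move=> u /andP[u0 _]; have := cC u; rewrite (ger0_norm u0) => /le_trans; apply.
  by rewrite gerDl oppr_le0.
have dEN (k : R) (u : R) : is_derive u (1 : R)
    (fun u => - (C * expR (k * u))) (- (k * C * expR (k * u))).
  exact: is_deriveN (dE k u).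
have := @row_derive_norm_le c c' _ _ s 0 s0 (fun u _ => dc u)
  (fun u _ => dEN (- (2 * L)) u).
rewrite mulr0 expR0 mulr1 distrC (ler0_norm s0) => H.
apply: le_trans (H _) _.
  move=> u /andP[_ u0]; have := cC u; rewrite (ler0_norm u0).
  by move=> /le_trans; apply; rewrite !mulrN !mulNr opprK.
by rewrite opprK addrC mulrN mulNr gerDl oppr_le0.
Qed.

End Picard.

Section PicardTheorem.
Variables (R : realType) (n : nat).
Implicit Types (F : 'rV[R]_n -> 'rV[R]_n) (c : R -> 'rV[R]_n).

Lemma halving_lt (a e : R) : 0 < e -> exists k : nat, a / 2 ^+ k < e.
Proof.
move=> e0; exists (Num.bound `|a / e|).
rewrite ltr_pdivrMr ?exprn_gt0// mulrC -ltr_pdivrMr//.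
apply: le_lt_trans (ler_norm _) _; apply: lt_le_trans (archi_boundP (normr_ge0 _)) _.
by rewrite -natrX ler_nat ltnW// ltn_expl.
Qed.

Lemma lipschitz_continuous (V W : normedModType R) (F : V -> W) (L : R) :
  (forall x y, `|F x - F y| <= L * `|x - y|) -> continuous F.
Proof.
move=> FL x; apply/cvgrPdist_le => e e0.
have L1 : 0 < `|L| + 1 by rewrite ltr_wpDl.
near=> y; apply: le_trans (FL x y) _.
apply: le_trans (_ : (`|L| + 1) * `|x - y| <= e).
  by rewrite ler_wpM2r// (le_trans (ler_norm L))// lerDl.
rewrite mulrC -ler_pdivlMr// ltW//; near: y.
have := @nbhsx_ballx _ V x _ (divr_gt0 e0 L1).
by rewrite -ball_normE.
Unshelve. all: by end_near. Qed.

(** Successive Picard iterates differ by at most [C / 2^k] times the weight, so they converge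
    uniformly on bounded intervals to a continuous [c]. The Picard image [Y] of [c] is
    differentiable by construction, and [Y = c] because both are within [C / 2^k] of [X (k + 1)],
    relative to the weight. *)
Theorem picard_lindelof F (L : R) : 0 < L ->
  (forall x y, `|F x - F y| <= L * `|x - y|) ->
  forall x, exists2 c, c 0 = x & forall s : R, is_derive s (1 : R) c (F (c s)).
Proof.
move=> L0 FL x.
have cF := lipschitz_continuous FL.
have step c : continuous c ->
    exists2 A : R -> 'rV[R]_n, A 0 = x & forall s : R, is_derive s (1 : R) A (F (c s)).
  move=> cc; have [s|A A0 dA] := @row_primitive_exists _ _ (fun s => F (c s)).
    by apply: (@continuous_comp _ _ _ c F); [exact: cc|exact: cF].
  exists (fun s => x + A s) => [|s]; first by rewrite A0 addr0.
  rewrite -[F _]add0r; exact: (is_deriveD (is_derive_cst x s 1) (dA s)).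
have contd c c' : (forall s : R, is_derive s (1 : R) c (c' s)) -> continuous c.
  by move=> dc s; exact: derive_continuous (dc s).
(* The iteration runs on continuous curves, since primitives exist only for these. *)
pose next (c : {c : R -> 'rV[R]_n | continuous c}) :
    {c : R -> 'rV[R]_n | continuous c} :=
  let A := cid2 (step (sval c) (svalP c)) in
  exist _ (s2val A) (contd _ _ (s2valP' A)).
have cx : continuous (cst x : R -> 'rV[R]_n) by exact: cst_continuous.
pose X k := sval (iter k next (exist _ (cst x) cx)).
have X0 : X 0%N = cst x by [].
have XS k : X k.+1 0 = x.
  by rewrite /X /= /next /=; case: (cid2 _).
have dX k (s : R) : is_derive s (1 : R) (X k.+1) (F (X k s)).
  by rewrite /X /= /next /=; case: (cid2 _) => A A0 /= /(_ s).
have Xx k : X k 0 = x by case: k => [|k]; rewrite ?X0 ?XS.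
pose w (s : R) := expR (2 * L * `|s|).
have w0 s : 0 < w s by apply: expR_gt0.
(* Chosen so that [2 L C = |F x|], the speed of the first iterate. *)
pose C := `|F x| / (2 * L).
have C0 : 0 <= C by rewrite divr_ge0// mulr_ge0// ltW.
have L2 : 2 * L != 0 by rewrite mulf_neq0 ?gt_eqF.
have p2 k : (0 : R) < 2 ^+ k by rewrite exprn_gt0.
have Ck k : 0 <= C / 2 ^+ k by rewrite divr_ge0// ltW.
have dist1 k s : `|X k.+1 s - X k s| <= C / 2 ^+ k * w s.
  elim: k s => [|k IH] s.
    rewrite expr0 divr1 X0 -[cst x s](XS 0%N).
    apply: (exp_weight_bound L0 C0 (dX 0%N)) => u.
    rewrite X0 /C (mulrC (2 * L)) divfK// ler_peMr// -expR0 ler_expR.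
    by rewrite mulr_ge0// mulr_ge0// ltW.
  have := @exp_weight_bound _ _ (fun s => X k.+2 s - X k.+1 s) _ L _ L0
    (Ck k.+1) (fun s => is_deriveB (dX k.+1 s) (dX k s)).
  rewrite !Xx subrr => /(_ _ s); rewrite subr0; apply=> u.
  apply: le_trans (FL _ _) _.
  apply: le_trans (ler_wpM2l (ltW L0) (IH u)) _.
  rewrite /w exprS le_eqVlt; apply/orP; left; apply/eqP.
  field; exact/lt0r_neq0/p2.
have dist k j s : `|X (k + j)%N s - X k s| <= 2 * C / 2 ^+ k * w s.
  (* The exact partial geometric sum is what an induction on [j] can carry. *)
  suff : `|X (k + j)%N s - X k s| <= 2 * C / 2 ^+ k * (1 - (2 ^+ j)^-1) * w s.
    move=> /le_trans; apply; rewrite (ler_wpM2r (ltW (w0 s)))//.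
    by apply: ler_piMr; [rewrite -mulrA mulr_ge0|rewrite gerBl invr_ge0 ltW].
  elim: j => [|j IH]; first by rewrite addn0 subrr normr0 expr0 invr1 subrr mulr0 mul0r.
  rewrite addnS -(subrKA (X (k + j)%N s)).
  apply: le_trans (ler_normD _ _) _; apply: le_trans (lerD (dist1 _ _) IH) _.
  rewrite exprD exprS !invfM le_eqVlt; apply/orP; left; apply/eqP.
  by field; rewrite !lt0r_neq0.
have small s e : 0 < e -> exists k, 2 * C / 2 ^+ k * w s < e.
  move=> e0; have [k kE] := halving_lt (2 * C * w s) e0; exists k.
  by rewrite mulrAC.
have cvgX s : cvg (X ^~ s @ \oo).
  apply: cauchy_cvg; apply: cauchy_exP => e e0.
  have [k ke] := small s e e0; exists (X k s); exists k => // j /= kj.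
  rewrite -ball_normE /= distrC; apply: le_lt_trans ke.
  by rewrite -(subnKC kj) dist.
pose c s := lim (X ^~ s @ \oo).
have distc k s : `|c s - X k s| <= 2 * C / 2 ^+ k * w s.
  have H : (fun j => `|X j s - X k s|) @ \oo --> `|c s - X k s|.
    apply: cvg_norm; apply: cvgB; [exact: cvgX|exact: cvg_cst].
  apply: (ler_cvg_to H (cvg_cst (2 * C / 2 ^+ k * w s))).
  by exists k => // j /= kj; rewrite -(subnKC kj) dist.
have cc : continuous c.
  move=> s; apply/cvgrPdist_lt => e e0.
  have e3 : 0 < e / 3 by rewrite divr_gt0.
  have [k ke] := small (`|s| + 1) (e / 3) e3.
  have wle u : `|u| <= `|s| + 1 -> 2 * C / 2 ^+ k * w u < e / 3.
    move=> us; apply: le_lt_trans ke; rewrite ler_wpM2l//.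
      by rewrite -mulrA mulr_ge0.
    rewrite ler_expR ler_wpM2l//; first by rewrite mulr_ge0// ltW.
    by rewrite [leRHS]ger0_norm ?addr_ge0.
  have Xc : continuous (X k) by exact: svalP (iter k next _).
  near=> u.
  have us : `|s - u| < 1 by near: u; exact: (@nbhsx_ballx _ R s 1 ltr01).
  have Xu : `|X k s - X k u| < e / 3.
    by near: u; have /cvgrPdist_lt := Xc s; apply.
  have u1 : `|u| <= `|s| + 1.
    have := ler_normD (u - s) s; rewrite subrK distrC; lra.
  have H1 := le_lt_trans (distc k u) (wle _ u1).
  have H2 : 2 * C / 2 ^+ k * w s < e / 3 by apply: wle; rewrite lerDl.
  have {}H2 := le_lt_trans (distc k s) H2.
  rewrite -(subrKA (X k s)); apply: le_lt_trans (ler_normD _ _) _.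
  rewrite -(subrKA (X k u) (X k s)).
  have := ler_normD (X k s - X k u) (X k u - c u); rewrite (distrC (X k u)).
  lra.
have [Y Y0 dY] := step c cc.
have distY k s : `|Y s - X k.+1 s| <= C / 2 ^+ k * w s.
  have := @exp_weight_bound _ _ (fun s => Y s - X k.+1 s) _ L _ L0
    (Ck k) (fun s => is_deriveB (dY s) (dX k s)).
  rewrite Y0 Xx subrr => /(_ _ s); rewrite subr0; apply=> u.
  apply: le_trans (FL _ _) _.
  apply: le_trans (ler_wpM2l (ltW L0) (distc k u)) _.
  by rewrite le_eqVlt; apply/orP; left; apply/eqP; rewrite /w; ring.
have Yc s : Y s = c s.
  apply/eqP; rewrite -subr_eq0 -normr_le0 leNgt; apply/negP => e0.
  have [k ke] := small s _ e0.
  suff : `|Y s - c s| <= 2 * C / 2 ^+ k * w s by rewrite leNgt ke.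
  rewrite -(subrKA (X k.+1 s)); apply: le_trans (ler_normD _ _) _.
  rewrite (distrC (X k.+1 s)); apply: le_trans (lerD (distY k s) (distc k.+1 s)) _.
  rewrite exprS invfM le_eqVlt; apply/orP; left; apply/eqP.
  by field; rewrite lt0r_neq0.
by exists Y => // s; rewrite Yc.
Unshelve. all: by end_near. Qed.

End PicardTheorem.

(** * Gronwall inequality, uniqueness and dependence on the initial point *)

Section Uniqueness.
Variables (R : realType) (n : nat).
Implicit Types (F : 'rV[R]_n -> 'rV[R]_n) (c : R -> 'rV[R]_n).

Definition locally_lipschitz (V W : normedModType R) (F : V -> W) :=
  forall B : R, exists2 L : R, 0 < L &
    forall x y, `|x| <= B -> `|y| <= B -> `|F x - F y| <= L * `|x - y|.

Lemma locally_lipschitz_continuous (V W : normedModType R) (F : V -> W) :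
  locally_lipschitz F -> continuous F.
Proof.
move=> FL x; have [L L0 FB] := FL (`|x| + 1).
apply/cvgrPdist_le => e e0; near=> y.
have xy1 : `|x - y| < 1.
  by near: y; have := @nbhsx_ballx _ V x _ (@ltr01 R); rewrite -ball_normE.
have y1 : `|y| <= `|x| + 1.
  by have := ler_normB x (x - y); rewrite subKr; lra.
apply: le_trans (FB _ _ _ y1) _; first by rewrite lerDl.
rewrite mulrC -ler_pdivlMr//; apply: ltW; near: y.
by have := @nbhsx_ballx _ V x _ (divr_gt0 e0 L0); rewrite -ball_normE.
Unshelve. all: by end_near. Qed.

Definition solution F (T : R) c :=
  forall s : R, 0 <= s <= T -> is_derive s (1 : R) c (F (c s)).

(** The sup norm is not differentiable, so the argument runs on the squared Euclidean norm of the
    difference. Comparing the two norms costs one factor [n] in the exponent and one in front. *)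
Lemma gronwall F (L T : R) c1 c2 : 0 <= L -> solution F T c1 -> solution F T c2 ->
  (forall s, 0 <= s <= T -> `|F (c1 s) - F (c2 s)| <= L * `|c1 s - c2 s|) ->
  forall s, 0 <= s <= T ->
    `|c1 s - c2 s| <= n%:R * expR (n%:R * L * T) * `|c1 0 - c2 0|.
Proof.
move=> L0 S1 S2 FL s /andP[s0 sT].
pose w u := c1 u - c2 u; pose w' u := F (c1 u) - F (c2 u).
have dw (u : R) : 0 <= u <= T -> is_derive u (1 : R) w (w' u).
  by move=> uT; apply: is_deriveB; [exact: S1|exact: S2].
have ww' u : 0 <= u <= T -> dot (w u) (w' u) <= n%:R * L * dot (w u) (w u).
  move=> uT; apply: le_trans (ler_norm _) _; apply: le_trans (cauchy_schwarz _ _) _.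
  rewrite -enorm_sqr expr2 mulrCA ler_wpM2l ?enorm_ge0//.
  apply: le_trans (enorm_le_norm _) _; rewrite -mulrA ler_wpM2l//.
  apply: le_trans (FL u uT) _; rewrite ler_wpM2l//; exact: norm_le_enorm.
have dD (u : R) : 0 <= u <= T ->
    is_derive u (1 : R) (fun u => dot (w u) (w u)) (2 * dot (w u) (w' u)).
  move=> uT; have dwi i := is_derive_coord i (dw u uT).
  have := is_derive_sum (fun i => is_deriveM (dwi i) (dwi i)).
  rewrite (_ : \sum_(i < n) _ = fun u => dot (w u) (w u)); last first.
    by apply/funext => v; rewrite fct_sumE.
  move/is_derive_eq; apply; rewrite /dot mulr_sumr; apply: eq_bigr => i _.
  by rewrite /GRing.scale /=; ring.
have : dot (w s) (w s) <= expR (2 * n%:R * L * s) * dot (w 0) (w 0).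
  (* The exponential factor compensates the growth permitted by [ww'], so [E] is nondecreasing. *)
  pose E u := - (expR (- (2 * n%:R * L) * u) * dot (w u) (w u)).
  pose E' u := - (expR (- (2 * n%:R * L) * u) *
    (2 * dot (w u) (w' u) - 2 * n%:R * L * dot (w u) (w u))).
  have dE (u : R) : 0 <= u <= s -> is_derive u (1 : R) E (E' u).
    move=> /andP[u0 us]; have uT : 0 <= u <= T by rewrite u0 (le_trans us sT).
    have de : is_derive u (1 : R) (fun u => expR (- (2 * n%:R * L) * u))
        (- (2 * n%:R * L) * expR (- (2 * n%:R * L) * u)).
      by apply: is_derive_eq; rewrite /GRing.scale /=; ring.
    have := is_deriveN (is_deriveM de (dD u uT)); move/is_derive_eq; apply.
    by rewrite /E' /GRing.scale /=; ring.
  have : E 0 <= E s.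
    apply: (derive_ge0_le s0 dE) => u /andP[u0 us].
    have uT : 0 <= u <= T by rewrite u0 (le_trans us sT).
    rewrite /E' oppr_ge0 mulr_ge0_le0 ?expR_ge0// subr_le0.
    by rewrite -!mulrA ler_wpM2l// mulrA ww'.
  rewrite /E mulr0 expR0 mul1r lerN2 mulNr expRN mulrC ler_pdivrMr ?expR_gt0//.
  by rewrite [leRHS]mulrC.
move=> H; apply: le_trans (norm_le_enorm _) _.
apply: (@le_trans _ _ (expR (n%:R * L * T) * enorm (w 0))); last first.
  rewrite [X in _ <= X * _]mulrC -[leRHS]mulrA ler_wpM2l ?expR_ge0//.
  exact: enorm_le_norm.
rewrite -(ler_pXn2r (n := 2))// ?nnegrE ?mulr_ge0 ?enorm_ge0 ?expR_ge0//.
rewrite exprMn !enorm_sqr -expRM_natl; apply: le_trans H _.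
rewrite ler_wpM2r ?dot_ge0// ler_expR -!mulrA.
by do 3 apply: ler_wpM2l => //.
Qed.

Lemma solution_bounded F (T : R) c : 0 <= T -> solution F T c ->
  exists B : R, forall s, 0 <= s <= T -> `|c s| <= B.
Proof.
move=> T0 Sc.
have cc : {within `[0, T], continuous (fun s => `|c s|)}.
  by move=> s; have /cvg_norm := derive_within_continuous Sc (x := s); apply.
have [u _ um] := EVT_max T0 cc.
by exists `|c u| => s sT; apply: um; rewrite in_itv.
Qed.

Lemma solution_unique F (T : R) c1 c2 : 0 <= T -> locally_lipschitz F ->
  solution F T c1 -> solution F T c2 -> c1 0 = c2 0 ->
  forall s, 0 <= s <= T -> c1 s = c2 s.
Proof.
move=> T0 FL S1 S2 c12 s sT.
have [B1 b1] := solution_bounded T0 S1; have [B2 b2] := solution_bounded T0 S2.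
have [L L0 FLB] := FL (Num.max B1 B2).
have := gronwall (ltW L0) S1 S2 _ sT; rewrite c12 subrr normr0 mulr0.
move=> H; apply/eqP; rewrite -subr_eq0 -normr_le0; apply: H => u uT.
by apply: FLB; rewrite le_max ?b1 ?b2 ?orbT.
Qed.

(* Solutions through nearby points are obtained by truncating the field outside
   a box, which makes it globally Lipschitz. *)
Lemma solution_nearby F (T : R) c : 0 <= T -> locally_lipschitz F ->
  solution F T c -> exists d C : R, [/\ 0 < d, 0 <= C &
    forall x, `|x - c 0| < d -> exists c1 : R -> 'rV[R]_n, [/\ c1 0 = x,
      solution F T c1 & forall s, 0 <= s <= T -> `|c1 s - c s| <= C * `|x - c 0|]].
Proof.
move=> T0 FL Sc; have [B b] := solution_bounded T0 Sc.
have B0 : 0 <= B by apply: le_trans (b 0 _) => //; rewrite lexx.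
have [L L0 FLB] := FL (B + 1).
pose trunc (y : R) := Num.max (- (B + 1)) (Num.min (B + 1) y).
have trunc_id y : `|y| <= B + 1 -> trunc y = y.
  by rewrite ler_norml /trunc => /andP[y1 y2]; rewrite min_r// max_r.
have trunc_le y : `|trunc y| <= B + 1.
  by rewrite ler_norml /trunc le_max lexx/= ge_max ge_min lexx/= andbT; lra.
have trunc_lip y z : `|trunc y - trunc z| <= `|y - z|.
  have cases u : [\/ trunc u = u /\ `|u| <= B + 1, trunc u = B + 1 /\ B + 1 <= u |
      trunc u = - (B + 1) /\ u <= - (B + 1)].
    have [u1|/ltW u1] := leP u (B + 1).
      have [u2|/ltW u2] := leP (- (B + 1)) u.
        by apply: Or31; rewrite trunc_id; rewrite ler_norml u2 u1.
      by apply: Or33; rewrite /trunc min_r// max_l.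
    by apply: Or32; rewrite /trunc min_l// max_r//; lra.
  have := ler_norm (y - z); have := ler_norm (- (y - z)); rewrite normrN.
  rewrite (ler_norml (trunc y - trunc z)).
  by case: (cases y) => -[->]; case: (cases z) => -[->]; rewrite ?ler_norml; lra.
pose tr (x : 'rV[R]_n) : 'rV[R]_n := \row_i trunc (x 0 i).
have tr_le x : `|tr x| <= B + 1.
  by apply: norm_le_coord => [|i]; rewrite ?mxE ?addr_ge0.
have tr_id x : `|x| <= B + 1 -> tr x = x.
  move=> xB; apply/rowP => i; rewrite mxE trunc_id//.
  exact: le_trans (coord_le_norm _ _) xB.
have tr_lip x y : `|tr x - tr y| <= `|x - y|.
  apply: norm_le_coord => // i; rewrite !mxE; apply: le_trans (trunc_lip _ _) _.
  by have := coord_le_norm (x - y) i; rewrite !mxE.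
have FtL x y : `|F (tr x) - F (tr y)| <= L * `|x - y|.
  apply: le_trans (FLB _ _ (tr_le x) (tr_le y)) _.
  exact: ler_wpM2l (ltW L0) _ _ (tr_lip x y).
pose C := n%:R * expR (n%:R * L * T).
have C0 : 0 <= C by rewrite mulr_ge0 ?expR_ge0.
have C1 : 0 < C + 1 by rewrite ltr_wpDl.
(* With this radius the truncated solution deviates from [c] by at most [C / (C + 1) <= 1]. It
   therefore stays in the box of size [B + 1], where truncation is the identity, and it solves the
   original equation. *)
exists (C + 1)^-1, C; split=> //; first by rewrite invr_gt0.
move=> x xd; have [c1 c10 dc1] := picard_lindelof L0 FtL x.
have S1 : solution (fun x => F (tr x)) T c1 by [].
have S : solution (fun x => F (tr x)) T c.
  move=> s sT; rewrite tr_id; first exact: Sc.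
  by rewrite (le_trans (b s sT))// lerDl.
have close s : 0 <= s <= T -> `|c1 s - c s| <= C * `|x - c 0|.
  move=> sT; rewrite -c10; apply: (gronwall (ltW L0) S1 S) sT => u uT.
  exact: FtL.
exists c1; split=> // s sT; have := dc1 s; rewrite tr_id//.
rewrite -(subrK (c s) (c1 s)); apply: le_trans (ler_normD _ _) _.
rewrite addrC lerD ?b//; apply: le_trans (close s sT) _.
rewrite -[leRHS](mulVf (lt0r_neq0 C1)) mulrC.
by apply: ler_pM => //; [exact: ltW|rewrite lerDl].
Qed.

End Uniqueness.

(** * Time reversal and the chosen flow *)

Section FlowReversal.
Variables (R : realType) (n : nat).
Implicit Types (F : 'rV[R]_n -> 'rV[R]_n) (c : R -> 'rV[R]_n).

Lemma is_derive_opp_arg c (s : R) (c' : 'rV[R]_n) : is_derive (- s) (1 : R) c c' ->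
  is_derive s (1 : R) (fun s => c (- s)) (- c').
Proof.
move=> [dc c'E].
have cd : differentiable c (- s) by exact/derivable1_diffP.
have od : differentiable (-%R : R -> R) s by exact: differentiableN.
have cod : differentiable (c \o -%R) s by exact: differentiable_comp.
split; first exact: diff_derivable.
have o1 : 'd (-%R : R -> R) s 1 = - 1 by rewrite -deriveE// derive_val.
by rewrite deriveE// (diff_comp od cd)/= o1 linearN/= -deriveE ?c'E.
Qed.

Lemma flows_toN F (t : R) x y : flows_to F t x y -> flows_to (fun z => - F z) (- t) x y.
Proof.
move=> [c [c0 ct dc]]; exists (fun s => c (- s)); split; rewrite ?oppr0 ?opprK//.
move=> s; rewrite -[X in Num.min X]oppr0 -[X in Num.max X]oppr0 -oppr_max -oppr_min.
move=> /andP[s1 s2]; apply: is_derive_opp_arg; apply: dc.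
by rewrite lerNr s2 lerNl s1.
Qed.

Lemma flows_to_opp F (t : R) x y :
  flows_to F (- t) x y <-> flows_to (fun z => - F z) t x y.
Proof.
split=> [/flows_toN|/flows_toN]; first by rewrite opprK.
by rewrite (_ : (fun z => - - F z) = F)//; apply/funext => z; rewrite opprK.
Qed.

Lemma flow_opp F (t : R) x : flow F (- t) x = flow (fun z => - F z) t x.
Proof.
by rewrite /flow; congr xget; apply/seteqP; split=> y /flows_to_opp.
Qed.

Lemma locally_lipschitzN F : locally_lipschitz F -> locally_lipschitz (fun z => - F z).
Proof.
move=> FL B; have [L L0 H] := FL B; exists L => // x y xB yB.
by rewrite -opprD normrN; exact: H.
Qed.

Lemma flows_to_solution F (T : R) x y : 0 <= T -> flows_to F T x y <->
  exists c, [/\ c 0 = x, c T = y & solution F T c].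
Proof.
by move=> T0; rewrite /flows_to /solution; split=> -[c [c0 cT dc]]; exists c;
  split=> // s; have := dc s; rewrite min_l// max_r.
Qed.

(** By uniqueness of solutions, the end point picked in [flow] is the only candidate. *)
Lemma flow_solution F (T : R) c : 0 <= T -> locally_lipschitz F ->
  solution F T c -> flow F T (c 0) = c T.
Proof.
move=> T0 FL Sc; rewrite /flow; case: xgetP => [y -> /flows_to_solution|].
  move=> /(_ T0)[c1 [c10 <- S1]].
  by apply: (solution_unique T0 FL S1 Sc); rewrite ?c10// T0 lexx.
by move=> /(_ (c T))[]; apply/flows_to_solution => //; exists c.
Qed.

End FlowReversal.

(** * Normal hyperbolicity of embedded tori *)

Section TorusGeometry.
Variables (R : realType) (d n : nat).
Implicit Types (h : 'rV[R]_d -> 'rV[R]_n).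

Lemma continuous_sum (T : topologicalType) (I : Type) (r : seq I) (f : I -> T -> R) :
  (forall i, continuous (f i)) -> continuous (fun x => \sum_(i <- r) f i x).
Proof.
move=> fc; elim: r => [|i r IH].
  by under eq_fun do rewrite big_nil; exact: cst_continuous.
under eq_fun do rewrite big_cons.
by move=> x; apply: continuousD; [exact: fc|exact: IH].
Qed.

Lemma is_derive_comp_diff (V W : normedModType R) (f : V -> W) (c : R -> V) (s : R) c' :
  differentiable f (c s) -> is_derive s (1 : R) c c' ->
  is_derive s (1 : R) (fun s => f (c s)) ('d f (c s) c').
Proof.
move=> fd [dc c'E]; have cd : differentiable c s by exact/derivable1_diffP.
have dfc : differentiable (f \o c) s by exact: differentiable_comp.
split; first exact: diff_derivable.
by rewrite deriveE// (diff_comp cd fd)/= -(deriveE _ cd) c'E.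
Qed.

Lemma is_derive_line (V : normedModType R) (x v : V) (s : R) :
  is_derive s (1 : R) (fun t => x + t *: v) v.
Proof.
have [di dE] := is_diff_scalel s v.
have dl : is_derive s (1 : R) (fun t => t *: v) v.
  by split; [exact/derivable1_diffP|rewrite deriveE// dE scale1r].
by have := is_deriveD (is_derive_cst x s 1) dl; rewrite add0r.
Qed.

Definition unit_cube : set 'rV[R]_d := [set x | forall i, 0 <= x 0 i <= 1].

Lemma unit_cube_compact : compact unit_cube.
Proof.
rewrite (_ : unit_cube = [set x | forall i, `[0, 1]%classic (x ord0 i)]).
  by apply: (@rV_compact R d (fun=> `[0, 1]%classic)) => i; exact: segment_compact.
by apply/seteqP; split=> x xi i; have := xi i; rewrite /= in_itv.
Qed.

Lemma unit_cube_floor (x : 'rV[R]_d) :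
  exists k, exists2 y, unit_cube y & x = y + map_mx (intr : int -> R) k.
Proof.
exists (\row_i Num.floor (x 0 i)), (\row_i (x 0 i - (Num.floor (x 0 i))%:~R)).
  move=> i; rewrite mxE subr_ge0 floor_le//= lerBlDr addrC -intrD1.
  by apply/ltW; case/andP: (floor_itv (x 0 i)).
by apply/rowP => i; rewrite !mxE subrK.
Qed.

Definition torus_periodic (T : Type) (f : 'rV[R]_d -> T) :=
  forall x (k : 'rV[int]_d), f (x + map_mx intr k) = f x.

Lemma periodic_max (f : 'rV[R]_d -> R) : continuous f -> torus_periodic f ->
  exists x0, forall x, f x <= f x0.
Proof.
move=> fc fp; have cube0 : unit_cube !=set0.
  by exists 0 => i; rewrite mxE lexx ler01.
have [c _ cm] := compact_EVT_max cube0 unit_cube_compact (continuous_subspaceT fc).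
exists c => x; have [k [y yc ->]] := unit_cube_floor x.
by rewrite fp; apply: cm; rewrite inE.
Qed.

Variable h : 'rV[R]_d -> 'rV[R]_n.
Hypothesis hh : torus_embedding h.

Lemma embedding_periodic : torus_periodic h.
Proof.
move=> x k; case: hh => /(_ x (x + map_mx intr k))[_ H] _ _ _ _.
by apply/esym/H; exists k.
Qed.

Lemma embedding_differentiable x : differentiable h x.
Proof. by case: hh. Qed.

Lemma embedding_continuous : continuous h.
Proof. by move=> x; exact/differentiable_continuous/embedding_differentiable. Qed.

Lemma diff_jacobian x v : 'd h x v = v *m jacobian h x.
Proof.
have dx := embedding_differentiable x.
by rewrite -(deriveEjacobian v dx) (deriveE v dx).
Qed.

Lemma jacobian_periodic : torus_periodic (jacobian h).
Proof.
move=> x k; set kk := map_mx intr k.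
have E y i j : jacobian h y i j = ('D_(delta_mx 0 i) h y) 0 j.
  by rewrite (deriveEjacobian _ (embedding_differentiable y)) -rowE [RHS]mxE.
have D v : 'D_v h (x + kk) = 'D_v h x.
  rewrite /derive (_ : (fun t => _) =
    (fun t : R => t^-1 *: ((h \o shift x) (t *: v) - h x)))//.
  by apply/funext => t /=; rewrite addrA !embedding_periodic.
by apply/matrixP => i j; rewrite [LHS]E [RHS]E D.
Qed.

Lemma jacobian_entry_continuous i j : continuous (fun x => jacobian h x i j).
Proof.
case: hh => _ _ Jc _ _ x.
apply: (@continuous_comp _ _ _ (jacobian h) (fun M : 'M[R]_(d, n) => M i j)).
  exact: Jc.
exact: coord_continuous.
Qed.

Lemma embedding_diff_bound :
  exists2 C : R, 0 <= C & forall x v, `|'d h x v| <= C * `|v|.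
Proof.
pose f x := \sum_j \sum_i `|jacobian h x i j|.
have fc : continuous f.
  apply: continuous_sum => j; apply: continuous_sum => i x.
  apply: (@continuous_comp _ _ _ (fun x => jacobian h x i j) (fun y : R => `|y|)).
    exact: jacobian_entry_continuous.
  exact: norm_continuous.
have fp : torus_periodic f by move=> x k; rewrite /f jacobian_periodic.
have [x0 x0m] := periodic_max fc fp; exists (f x0).
  by apply: sumr_ge0 => j _; exact: sumr_ge0.
move=> x v; apply: le_trans (ler_wpM2r (normr_ge0 v) (x0m x)).
apply: norm_le_coord => [|j].
  by rewrite mulr_ge0//; apply: sumr_ge0 => j _; exact: sumr_ge0.
rewrite diff_jacobian mxE mulr_suml (bigD1 j)//=.
apply: le_trans (_ : _ <= (\sum_i `|jacobian h x i j|) * `|v|) _; last first.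
  rewrite lerDl; apply: sumr_ge0 => k _; rewrite mulr_ge0//.
  exact: sumr_ge0.
apply: le_trans (ler_norm_sum _ _ _) _; rewrite mulr_suml; apply: ler_sum => i _.
by rewrite normrM mulrC ler_wpM2l// coord_le_norm.
Qed.

Lemma embedding_lipschitz : exists2 C : R, 0 <= C &
  forall x y, `|h x - h y| <= C * `|x - y|.
Proof.
have [C C0 hC] := embedding_diff_bound; exists C => // x y.
have dc (s : R) : is_derive s (1 : R) (fun s => h (y + s *: (x - y)))
    ('d h (y + s *: (x - y)) (x - y)).
  apply: is_derive_comp_diff; first exact: embedding_differentiable.
  exact: is_derive_line.
have dg (s : R) : is_derive s (1 : R) (fun s : R => s * (C * `|x - y|)) (C * `|x - y|).
  by apply: is_derive_eq; rewrite scaler0 add0r /GRing.scale /= mulr1.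
have := row_derive_norm_le ler01 (fun s _ => dc s) (fun s _ => dg s) (fun s _ => hC _ _).
by rewrite scale1r scale0r addr0 subrKC mul1r mul0r subr0.
Qed.

(** On the product of the unit cube and the unit sphere, [|v J(x)|] attains a minimum, which is
    positive because the differential is injective; periodicity extends the bound to all [x]. *)
Lemma embedding_diff_lower_bound :
  exists2 C : R, 0 <= C & forall x v, `|v| <= C * `|'d h x v|.
Proof.
pose S : set 'rV[R]_d := [set v | `|v| = 1].
have nc : continuous (fun v : 'rV[R]_d => `|v|) by exact: norm_continuous.
have Sc : compact S.
  apply: bounded_closed_compact.
    by exists 1; split=> // M M1 v /= ->; exact: ltW.
  rewrite (_ : S = (fun v => `|v|) @^-1` [set 1])//.
  by apply: preimage_closed => //; exact: closed1.
have Kc := compact_setX unit_cube_compact Sc.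
pose f (p : 'rV[R]_d * 'rV[R]_d) := `|p.2 *m jacobian h p.1|.
have fc : continuous f.
  suff Jc : continuous (fun p : 'rV[R]_d * 'rV[R]_d => p.2 *m jacobian h p.1).
    by move=> p; have /cvg_norm := Jc p; apply.
  apply: row_continuous => j.
  rewrite (_ : (fun p => _) = fun p : 'rV[R]_d * 'rV[R]_d =>
      \sum_i p.2 0 i * jacobian h p.1 i j); last first.
    by apply/funext => p; rewrite mxE.
  apply: continuous_sum => i p; apply: continuousM.
    apply: (@continuous_comp _ _ _ snd (fun v : 'rV[R]_d => v 0 i)); first exact: cvg_snd.
    exact: continuous_coord.
  apply: (@continuous_comp _ _ _ fst (fun x => jacobian h x i j)); first exact: cvg_fst.
  exact: jacobian_entry_continuous.
(* The unit sphere is empty when [d = 0]; then every vector is [0]. *)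
have [S0|S0] := pselect (S !=set0); last first.
  exists 0 => // x v; rewrite mul0r; apply: contrapT => /negP; rewrite -ltNge => v0.
  apply: S0; exists (`|v|^-1 *: v); rewrite /S/= normrZ normfV normr_id mulVf//.
  exact: lt0r_neq0.
have K0 : (unit_cube `*` S) !=set0.
  by case: S0 => v Sv; exists (0, v); split=> //= i; rewrite mxE lexx ler01.
have [[x0 v0] + fm] := compact_EVT_min K0 Kc (continuous_subspaceT fc).
rewrite inE => -[/= _ v01].
have f0 : 0 < f (x0, v0).
  rewrite normr_gt0 /= -diff_jacobian; apply/eqP => E.
  case: hh => _ _ _ inj _; have := inj x0 v0 0; rewrite linear0 => /(_ E) v00.
  by have := v01; rewrite /S /= v00 normr0 => /eqP; rewrite eq_sym oner_eq0.
exists (f (x0, v0))^-1; first by rewrite invr_ge0 ltW.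
move=> x v; have [->|vn0] := eqVneq v 0; first by rewrite normr0 mulr_ge0// invr_ge0 ltW.
have v1 : 0 < `|v| by rewrite normr_gt0.
rewrite mulrC ler_pdivlMr// -ler_pdivlMl//.
have [k [y yc xE]] := unit_cube_floor x.
have : f (x0, v0) <= f (y, `|v|^-1 *: v).
  apply: fm; rewrite inE; split=> //=.
  by rewrite /S /= normrZ normfV normr_id mulVf// lt0r_neq0.
rewrite [X in _ <= X]/f /= -scalemxAl normrZ normfV normr_id.
by rewrite -(jacobian_periodic y k) -xE -diff_jacobian.
Qed.

End TorusGeometry.

(** * A criterion for normal hyperbolicity *)

Section Criterion.
Variables (R : realType) (d : nat).
Implicit Types (h : 'rV[R]_d -> 'rV[R]_d.+1) (F : 'rV[R]_d.+1 -> 'rV[R]_d.+1).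

(** The Jacobian has rank [d], so the vectors orthogonal to its rows form a line, and [g] is a
    nonzero element of it. *)
Lemma normal_line h x (p g : 'rV[R]_d.+1) : torus_embedding h -> h x = p ->
  g != 0 -> (forall u, dot g ('d h x u) = 0) ->
  forall w, normal_at h p w -> exists a, w = a *: g.
Proof.
move=> hh hx g0 gT w wN; set J := jacobian h x.
have Jfree : row_free J.
  apply: inj_row_free => v; rewrite -diff_jacobian// => vJ.
  case: hh => _ _ _ inj _; apply: (inj x).
  by rewrite vJ linear0.
have ker u : (forall v, dot u (v *m J) = 0) -> (u <= kermx J^T)%MS.
  move=> uT; apply/sub_kermxP; apply/rowP => i; rewrite [RHS]mxE.
  rewrite -(uT (delta_mx 0 i)) -dot_mulmx trmx_mul mulmxA trmx_delta.
  by rewrite -colE [RHS]mxE.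
have gk : (g <= kermx J^T)%MS.
  by apply: ker => v; rewrite -diff_jacobian.
have wk : (w <= kermx J^T)%MS.
  by apply: ker => v; rewrite -diff_jacobian// dotC; apply: wN; exists x, v.
have rk : \rank (kermx J^T) = 1%N.
  by rewrite mxrank_ker mxrank_tr (eqP Jfree) subSnn.
have : (kermx J^T <= g)%MS.
  by rewrite -(mxrank_leqif_sup gk).2 rk rank_rV g0.
by move=> /(submx_trans wk) /sub_rVP[a ->]; exists a.
Qed.

(** In codimension one this reduces the normal bound to an estimate of the scalar [dot g v]. *)
Lemma enorm_orth_proj_line n (V : set 'rV[R]_n) g v : g != 0 ->
  (forall a, V (a *: g)) -> (forall w, V w -> exists a, w = a *: g) ->
  enorm (orth_proj V v) = `|dot g v| / enorm g.
Proof.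
move=> g0 Vg VE; have gg := dot_gt0 g0; have eg := enorm_gt0 g0.
have fin (a : R) : a * dot g g = dot g v -> enorm (a *: g) = `|dot g v| / enorm g.
  move=> <-; rewrite normrM (ger0_norm (dot_ge0 g)) -enorm_sqr enormZ expr2.
  by rewrite mulrA mulfK// gt_eqF.
have := Vg 1; rewrite scale1r => Vg1.
rewrite /orth_proj; case: xgetP => [w _ [Vw ow]|].
  have [a wE] := VE _ Vw; rewrite wE; apply: fin.
  have := ow g Vg1; rewrite wE dotBr dotZr => /eqP.
  by rewrite subr_eq0 => /eqP.
pose a := dot g v / dot g g.
have aE : a * dot g g = dot g v by rewrite divfK// gt_eqF.
move=> /(_ (a *: g))[]; split=> // w /VE[b ->].
by rewrite dotZl dotBr dotZr aE subrr mulr0.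
Qed.

(** Along a solution [G' = K G], so [G^2 exp (2 e s)] has derivative
    [2 G^2 (K + e) exp (2 e s) <= 0]. Squaring makes the sign of [G] irrelevant. *)
Lemma exp_decay n (F : 'rV[R]_n -> 'rV[R]_n) (G K : 'rV[R]_n -> R) g (e T : R) (c : R -> 'rV[R]_n) :
  C1 G g -> (forall x, dot (g x) (F x) = K x * G x) -> 0 <= T ->
  solution F T c -> (forall s, 0 <= s <= T -> K (c s) <= - e) ->
  `|G (c T)| <= expR (- e * T) * `|G (c 0)|.
Proof.
move=> Gg gF T0 Sc Ke.
pose f s := - (G (c s) * G (c s) * expR (2 * e * s)).
pose f' s := - (2 * (G (c s) * G (c s)) * (K (c s) + e) * expR (2 * e * s)).
have df (s : R) : 0 <= s <= T -> is_derive s (1 : R) f (f' s).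
  move=> sT; have dG := C1_along Gg (Sc s sT); rewrite gF in dG.
  have de : is_derive s (1 : R) (fun s => expR (2 * e * s))
      (2 * e * expR (2 * e * s)).
    by apply: is_derive_eq; rewrite /GRing.scale /=; ring.
  have := is_deriveN (is_deriveM (is_deriveM dG dG) de).
  by move/is_derive_eq; apply; rewrite /f' /GRing.scale /= !fctE; ring.
have : f 0 <= f T.
  apply: (derive_ge0_le T0 df) => s sT; rewrite /f' oppr_ge0.
  apply: mulr_le0_ge0 (expR_ge0 _); apply: mulr_ge0_le0.
    by rewrite mulr_ge0// -expr2 sqr_ge0.
  by rewrite -lerBrDr sub0r Ke.
rewrite /f mulr0 expR0 mulr1 lerN2 => H.
rewrite -(ler_pXn2r (n := 2))// ?nnegrE ?mulr_ge0 ?expR_ge0//.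
rewrite exprMn !real_normK ?num_real// [leRHS]mulrC.
have <- : G (c T) * G (c T) * expR (2 * e * T) * expR (- e * T) ^+ 2 = G (c T) ^+ 2.
  rewrite -mulrA -expRM_natl -expRD (_ : _ + _ = 0) ?expR0 ?mulr1//; ring.
by rewrite ler_wpM2r ?sqr_ge0// [leRHS]expr2.
Qed.

Lemma is_derive_comp_shift n (c : R -> 'rV[R]_n) (a s : R) c' :
  is_derive (a + s) (1 : R) c c' -> is_derive s (1 : R) (fun u => c (a + u)) c'.
Proof.
move=> [dc dE]; have cd : differentiable c (a + s) by exact/derivable1_diffP.
have da : is_derive s (1 : R) (fun u => a + u) 1.
  by have := is_deriveD (is_derive_cst a s 1) (is_derive_id s 1); rewrite add0r.
by have := is_derive_comp_diff cd da; rewrite -(deriveE _ cd) dE.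
Qed.

(* The bounds hold trivially at points where [flow F t] is not differentiable,
   since its differential is then [0]; elsewhere they follow from bounds on
   difference quotients.  The rate of [K] along an orbit near the torus controls
   [G], hence the component of the differential along [g]. *)
Theorem normal_hyperbolicity_criterion (r : nat) F h
    (Psi : R -> 'rV[R]_d -> 'rV[R]_d) (G K : 'rV[R]_d.+1 -> R) g :
  locally_lipschitz F -> torus_embedding h ->
  (forall s, Psi 0 s = s) ->
  (forall s (t : R),
    is_derive t (1 : R) (fun t => h (Psi t s)) (F (h (Psi t s)))) ->
  (forall rho : R, 0 < rho -> exists2 C : R, 0 <= C & forall t s s',
    `|Psi t s - Psi t s'| <= C * expR (rho * `|t|) * `|s - s'|) ->
  C1 G g -> (forall x, dot (g x) (F x) = K x * G x) ->
  locally_lipschitz K ->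
  (forall s, [/\ G (h s) = 0, g (h s) != 0 & K (h s) < 0]) ->
  attracting_normally_hyperbolic r F h.
Proof.
move=> FL hh Psi0 Psih PsiL Gg gF KL GK.
have Kc := locally_lipschitz_continuous KL.
have hd := embedding_differentiable hh.
have hc := embedding_continuous hh.
have hp := embedding_periodic hh.
have flow_ge0 s s' (t : R) : 0 <= t ->
    flow F t (h (Psi s' s)) = h (Psi (s' + t) s).
  move=> t0; have S : solution F t (fun u => h (Psi (s' + u) s)).
    by move=> u _; exact: (is_derive_comp_shift (c := fun u => h (Psi u s))).
  by have := flow_solution t0 FL S; rewrite addr0.
have flowE s t : flow F t (h s) = h (Psi t s).
  have [t0|/ltW t0] := leP 0 t; first by have := flow_ge0 s 0 t t0; rewrite Psi0 add0r.
  rewrite -[t]opprK flow_opp; have Nt0 : 0 <= - t by rewrite oppr_ge0.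
  have S : solution (fun z => - F z) (- t) (fun u => h (Psi (- u) s)).
    by move=> u _; exact: (is_derive_opp_arg (c := fun u => h (Psi u s))).
  by have := flow_solution Nt0 (locally_lipschitzN FL) S; rewrite oppr0 Psi0.
have comp_c (f : 'rV[R]_d.+1 -> R) : continuous f -> continuous (fun s => f (h s)).
  by move=> fc s; apply: (@continuous_comp _ _ _ h f); [exact: hc|exact: fc].
have [sK sKm] := periodic_max (comp_c K Kc) (fun x k => congr1 K (hp x k)).
have [_ _ K0] := GK sK.
(* Half of the weakest rate on the torus; the other half is the margin for orbits that are only near
   the torus. *)
pose kap := - K (h sK) / 2; have kap0 : 0 < kap by rewrite divr_gt0 ?oppr_gt0.
have Kkap s : K (h s) <= - kap - kap.
  by apply: le_trans (sKm s) _; rewrite /kap; lra.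
(* With [rhoN = kap] this gives [r rhoM < rhoN]. *)
pose rhoM := kap / r.+1%:R.
have rhoM0 : 0 < rhoM by rewrite divr_gt0.
have [Ch Ch0 hCh] := embedding_lipschitz hh.
have [Cl Cl0 hCl] := embedding_diff_lower_bound hh.
have [CP CP0 hCP] := PsiL _ rhoM0.
have gnc : continuous (fun x => `|g x|).
  by move=> x; have /cvg_norm := proj2 Gg x; apply.
have [sM sMm] := periodic_max (comp_c _ gnc) (fun x k => congr1 (fun y => `|g y|) (hp x k)).
have gnNc : continuous (fun x => - `|g x|) by move=> x; exact: continuousN (gnc x).
have [sm smm] := periodic_max (comp_c _ gnNc) (fun x k => congr1 (fun y => - `|g y|) (hp x k)).
have {}smm s : `|g (h sm)| <= `|g (h s)| by rewrite -lerN2 smm.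
have gm0 : 0 < `|g (h sm)| by rewrite normr_gt0; case: (GK sm).
have [sB sBm] := periodic_max (comp_c _ (@norm_continuous _ _)) (fun x k => congr1 Num.norm (hp x k)).
have [LK LK0 hLK] := KL (`|h sB| + 1).
have gT s u : dot (g (h s)) ('d h s u) = 0.
  have dl := is_derive_comp_diff (hd (s + 0 *: u)) (is_derive_line s u 0).
  have := C1_along Gg dl; rewrite scale0r addr0 => -[_ <-].
  rewrite (_ : (fun t => _) = cst 0) ?derive_cst//.
  by apply/funext => t; case: (GK (s + t *: u)).
(* [Cl] bounds the angular preimage of a unit tangent vector, [CP] its growth under [Psi], [Ch] the
   effect of [h], and [d + 1] compares the norms. In [KB] the quotient compares the largest and the
   smallest gradient on the torus. The summand [2] makes both constants exceed [1]. *)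
pose KA := d.+1%:R * (Ch * CP * Cl) + 2.
pose KB := d.+1%:R * `|g (h sM)| / `|g (h sm)| + 2.
have KA0 : 0 <= d.+1%:R * (Ch * CP * Cl) by rewrite !mulr_ge0.
have KB0 : 0 <= d.+1%:R * `|g (h sM)| / `|g (h sm)| by rewrite divr_ge0 ?mulr_ge0.
exists KA, KB, rhoM, kap; split.
- by split=> //; rewrite /KA /KB; lra.
- move=> t p [s0 _ _]; apply: ub_ereal_sup => _ [v [[s [u [sp vE]]] v1] <-].
  rewrite lee_fin vE -sp; set D := 'd _ _.
  (* On the curve [h (s + e u)] the flow is [h (Psi (- t) (s + e u))], so its increments are bounded
     by the Lipschitz constants of [h] and [Psi]. *)
  have Du : `|D ('d h s u)| <= Ch * CP * expR (rhoM * `|t|) * `|u|.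
    have [df|ndf] := pselect (differentiable (flow F (- t)) (h s)); last first.
      by rewrite /D diff_nondifferentiable// normr0 !mulr_ge0 ?expR_ge0.
    have dl := is_derive_comp_diff (hd (s + 0 *: u)) (is_derive_line s u 0).
    have df0 : differentiable (flow F (- t)) (h (s + 0 *: u)).
      by rewrite scale0r addr0.
    have dfl := is_derive_comp_diff df0 dl.
    have := norm_le_derive dfl (is_derive_line s u 0).
    rewrite scale0r addr0; apply; first by rewrite !mulr_ge0 ?expR_ge0.
    near=> e; rewrite !flowE; apply: le_trans (hCh _ _) _.
    apply: le_trans (ler_wpM2l Ch0 (hCP (- t) _ _)) _.
    by rewrite normrN !mulrA.
  apply: le_trans (enorm_le_norm _) _.
  apply: (@le_trans _ _ (d.+1%:R * (Ch * CP * Cl) * expR (rhoM * `|t|))); last first.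
    by rewrite ler_wpM2r ?expR_ge0// /KA lerDl.
  rewrite -mulrA ler_wpM2l//; apply: le_trans Du _.
  have u1 : `|u| <= Cl.
    apply: le_trans (hCl s u) _; rewrite -[leRHS]mulr1 ler_wpM2l//.
    by apply: le_trans (norm_le_enorm _) _; rewrite -vE.
  rewrite [leRHS]mulrAC ler_wpM2l//.
  by apply: mulr_ge0 (expR_ge0 _); exact: mulr_ge0.
- move=> t p t0 [s _ sp]; apply: ub_ereal_sup => _ [v [_ v1] <-].
  rewrite lee_fin -sp flowE; set s1 := Psi (- t) s; set D := 'd _ _.
  have flow1 : flow F t (h s1) = h s by rewrite flow_ge0// addNr Psi0.
  have [Gs gs _] := GK s.
  rewrite (enorm_orth_proj_line _ gs); last 2 first.
  + move=> a _ [x [u [xs ->]]].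
    by rewrite dotZr dotC -xs gT mulr0.
  + exact: normal_line hh (erefl (h s)) gs (gT s).
  (* The two products are the derivatives at [e = 0] of [G] after and before flowing from
     [h s1 + e v]; [G] vanishes at both base points, so [exp_decay] compares the increments. *)
  have Dv : `|dot (g (h s)) (D v)| <= expR (- kap * t) * `|dot (g (h s1)) v|.
    have [df|ndf] := pselect (differentiable (flow F t) (h s1)); last first.
      by rewrite /D diff_nondifferentiable// dotC dot0l normr0 mulr_ge0 ?expR_ge0.
    have dl := is_derive_line (h s1) v 0.
    have df0 : differentiable (flow F t) (h s1 + 0 *: v) by rewrite scale0r addr0.
    have da := C1_along Gg (is_derive_comp_diff df0 dl).
    have db := C1_along Gg dl.
    have := norm_le_derive da db; rewrite scale0r addr0 flow1.
    apply; first exact: expR_ge0.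
    have S1 : solution F t (fun u => h (Psi u s1)) by move=> u _; exact: Psih.
    have [dl0 [C [dl00 C0 near_sol]]] := solution_nearby t0 FL S1.
    rewrite Psi0 in near_sol.
    (* Starting closer than [eta], the orbit stays within [1] of the orbit on the torus, where [LK]
       is a Lipschitz constant of [K], and within [kap / LK], so that [K] changes by at most
       [kap]. *)
    pose eta := Num.min dl0 (Num.min 1 (kap / LK) / (C + 1)).
    have C1' : 0 < C + 1 by rewrite ltr_wpDl.
    have eta0 : 0 < eta by rewrite lt_min dl00 divr_gt0// lt_min ltr01 divr_gt0.
    have v10 : 0 < `|v| + 1 by rewrite ltr_wpDl.
    near=> e.
    have e1 : `|e| < eta / (`|v| + 1).
      near: e; apply/nbhs_ballP; exists (eta / (`|v| + 1)); first exact: divr_gt0.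
      by move=> u; rewrite -ball_normE/= sub0r normrN.
    have ev : `|h s1 + e *: v - h s1| < eta.
      rewrite addrAC subrr add0r normrZ.
      apply: (@le_lt_trans _ _ (`|e| * (`|v| + 1))); first by rewrite ler_wpM2l// lerDl.
      by rewrite -ltr_pdivlMr.
    have evd : `|h s1 + e *: v - h s1| < dl0 by apply: lt_le_trans ev _; rewrite ge_min lexx.
    have [c1 [c10 Sc1 close]] := near_sol _ evd.
    have [Gs1 _ _] := GK s1.
    rewrite Gs Gs1 !subr0 -c10 (flow_solution t0 FL Sc1).
    apply: (exp_decay Gg gF t0 Sc1) => u ut.
    have cu : `|c1 u - h (Psi u s1)| <= Num.min 1 (kap / LK).
      apply: le_trans (close u ut) _.
      apply: (@le_trans _ _ ((C + 1) * eta)).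
        by rewrite ler_pM// ?lerDl// ltW.
      by rewrite mulrC -ler_pdivlMr// /eta ge_min lexx orbT.
    have := cu; rewrite le_min => /andP[cu1 cu2].
    have Kd : `|K (c1 u) - K (h (Psi u s1))| <= kap.
      have hB := sBm (Psi u s1); apply: le_trans (hLK _ _ _ _) _.
      - have := ler_normD (c1 u - h (Psi u s1)) (h (Psi u s1)); rewrite subrK.
        by move/le_trans; apply; rewrite addrC lerD.
      - by apply: le_trans hB _; rewrite lerDl.
      - by rewrite mulrC -ler_pdivlMr.
    by have := Kkap (Psi u s1); have := ler_norm (K (c1 u) - K (h (Psi u s1))); lra.
  have egs := enorm_gt0 gs.
  rewrite ler_pdivrMr//; apply: le_trans Dv _.
  rewrite [KB * _]mulrC -mulrA ler_wpM2l ?expR_ge0//.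
  apply: le_trans (cauchy_schwarz _ _) _.
  apply: (@le_trans _ _ (d.+1%:R * `|g (h sM)| / `|g (h sm)| * `|g (h sm)|)).
    rewrite divfK ?gt_eqF// -[leRHS]mulr1; apply: ler_pM; rewrite ?enorm_ge0//.
    by apply: le_trans (enorm_le_norm _) _; rewrite ler_wpM2l.
  apply: ler_pM => //; first by rewrite lerDl.
  by apply: le_trans (smm s) (norm_le_enorm _).
- rewrite /rhoM mulrCA gtr_pMr//.
  by rewrite ltr_pdivrMr// mul1r ltr_nat.
Unshelve. all: by end_near. Qed.

End Criterion.

(** * The torus of the tower of polynomials *)

Section LocalInverse.
Variable R : realType.
Implicit Types p : {poly R}.

(** Near a simple root [p] is strictly monotone, so the intermediate value theorem supplies the
    inverse. The sign of the derivative is recorded relative to that at the root: it later decides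
    whether a torus attracts or repels. *)
Lemma poly_local_inverse p x0 eta : 0 < eta -> p.[x0] = 0 -> p^`().[x0] != 0 ->
  exists2 a : R, 0 < a & exists psi : R -> R, forall y, `|y| < a ->
    [/\ p.[psi y] = y, `|psi y - x0| < eta, 0 < p^`().[psi y] * p^`().[x0] &
      is_derive y (1 : R) psi (p^`().[psi y])^-1].
Proof.
move=> eta0 px0 p'0.
have dp (x : R) : is_derive x (1 : R) (horner p) p^`().[x] by exact: is_derive_poly.
have [e e0 [ee e_pos]] : exists2 e : R, 0 < e & e <= eta /\
    forall x, `|x - x0| < e -> 0 < p^`().[x] * p^`().[x0].
  have p'c := @continuous_horner _ p^`() x0.
  have p0 : 0 < `|p^`().[x0]| by rewrite normr_gt0.
  have /cvgrPdist_lt/(_ _ p0)/nbhs_ballP[e /= e0 he] := p'c.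
  exists (Num.min e eta); first by rewrite lt_min e0.
  split=> [|x]; first by rewrite ge_min lexx orbT.
  rewrite lt_min => /andP[xe _].
  have := he x; rewrite -ball_normE /= distrC => /(_ xe).
  have [pp|pp|/esym/eqP] := ltgtP 0 p^`().[x0]; last by rewrite (negbTE p'0).
    rewrite (gtr0_norm pp) => /(le_lt_trans (ler_norm _)) H.
    by rewrite mulr_gt0//; lra.
  rewrite (ltr0_norm pp) distrC => /(le_lt_trans (ler_norm _)) H.
  by rewrite nmulr_lgt0//; lra.
have inj u v : `|u - x0| < e -> `|v - x0| < e -> p.[u] = p.[v] -> u = v.
  wlog uv : u v / u < v => [th|] ue ve puv.
    have [uv|vu|//] := ltgtP u v; first exact: th uv ue ve puv.
    by apply/esym/(th v u).
  have [c +] := MVT uv (fun x _ => dp x) (derive_within_continuous (fun x _ => dp x)).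
  rewrite in_itv /= => /andP[uc cv]; rewrite puv subrr => /esym/eqP.
  rewrite mulf_eq0 subr_eq0 (gt_eqF uv) orbF => /eqP c0.
  have ce : `|c - x0| < e by move: ue ve; rewrite !ltr_norml; lra.
  by have := e_pos c ce; rewrite c0 mul0r ltxx.
have [e2 e20 e2e] : exists2 e2 : R, 0 < e2 & e2 < e by exists (e / 2); lra.
have pc : continuous (horner p) by exact: continuous_horner.
have lt1 : x0 < x0 + e2 by rewrite ltrDl.
have lt2 : x0 - e2 < x0 by rewrite gtrBl.
have [c1 + E1] := MVT lt1 (fun x _ => dp x) (continuous_subspaceT pc).
have [c2 + E2] := MVT lt2 (fun x _ => dp x) (continuous_subspaceT pc).
rewrite !in_itv /= => /andP[c21 c22] /andP[c11 c12].
have {}E1 : p.[x0 + e2] = p^`().[c1] * e2 by move: E1; rewrite px0 subr0 addrAC subrr add0r.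
have {}E2 : p.[x0 - e2] = - (p^`().[c2] * e2).
  by move: E2; rewrite px0 sub0r subKr => <-; rewrite opprK.
have p1 : 0 < p^`().[c1] * p^`().[x0] by apply: e_pos; rewrite ltr_norml; lra.
have p2 : 0 < p^`().[c2] * p^`().[x0] by apply: e_pos; rewrite ltr_norml; lra.
(* The values at the two ends have opposite signs, so each [y] with [|y| < a] lies between them. *)
pose a := Num.min `|p.[x0 + e2]| `|p.[x0 - e2]|.
have a0 : 0 < a.
  have e2n : e2 != 0 by rewrite gt_eqF.
  by rewrite lt_min !normr_gt0 E1 E2 oppr_eq0; apply/andP; split; apply: mulf_neq0 => //;
    apply/eqP => c0; [move: p1|move: p2]; rewrite c0 mul0r ltxx.
pose psi y := xget x0 [set x | `|x - x0| < e /\ p.[x] = y].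
exists a => //; exists psi => y ya.
have le12 : x0 - e2 <= x0 + e2 by lra.
have [c + cy] : exists2 c, c \in `[x0 - e2, x0 + e2] & p.[c] = y.
  apply: IVT le12 (continuous_subspaceT pc) _.
  move: ya; rewrite /a lt_min !ltr_norml E1 E2 normrN !normrM (gtr0_norm e20).
  rewrite ge_min le_max.
  have [q|q|/esym/eqP] := ltgtP 0 p^`().[x0]; last by rewrite (negbTE p'0).
    move: p1 p2; rewrite !(pmulr_lgt0 _ q) => p1 p2; rewrite (gtr0_norm p1) (gtr0_norm p2).
    by move=> /andP[/andP[? /ltW h1] /andP[/ltW h2 ?]]; rewrite h1 h2 orbT.
  move: p1 p2; rewrite !(nmulr_lgt0 _ q) => p1 p2; rewrite (ltr0_norm p1) (ltr0_norm p2).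
  rewrite !mulNr !opprK.
  by move=> /andP[/andP[/ltW h1 ?] /andP[? /ltW h2]]; rewrite h1 h2 orbT.
rewrite in_itv /= => /andP[cx1 cx2].
have ce : `|c - x0| < e by rewrite ltr_norml; lra.
have cancel x : `|x - x0| < e -> psi p.[x] = x.
  move=> xe; rewrite /psi; case: xgetP => [z _ [ze zp]|/(_ x)[]//].
  exact: inj.
have psic : psi y = c by rewrite -cy cancel.
rewrite psic; split=> //; first exact: lt_le_trans ce ee.
  exact: e_pos.
rewrite -cy; apply: is_derive_inverse.
- near=> x; apply: cancel.
  have : `|c - x| < e - `|c - x0|.
    near: x; have r0 : 0 < e - `|c - x0| by rewrite subr_gt0.
    exact: (@nbhsx_ballx _ R c _ r0).
  have := ler_normD (x - c) (c - x0); rewrite subrKA (distrC x c); lra.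
- by near=> x; exact: pc.
- by apply/eqP => c0; have := e_pos c ce; rewrite c0 mul0r ltxx.
Unshelve. all: by end_near. Qed.

(** The simple roots [0, ..., n - 1] have spacing one, so neighbourhoods of radius [1/2] tell them
    apart. *)
Definition root_poly (n : nat) : {poly R} := \prod_(i < n) ('X - (i%:R)%:P).

Lemma size_root_poly n : size (root_poly n) = n.+1.
Proof.
rewrite /root_poly -(big_mkord xpredT (fun i => 'X - (i%:R)%:P)).
by rewrite size_prod_XsubC size_iota subn0.
Qed.

Lemma root_poly_root n k : (k < n)%N -> (root_poly n).[k%:R] = 0.
Proof.
move=> kn; apply/rootP; rewrite /root_poly (bigD1 (Ordinal kn))//= rootM.
by rewrite root_XsubC eqxx.
Qed.

Lemma root_poly_deriv_neq0 n k : (k < n)%N -> (root_poly n)^`().[k%:R] != 0.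
Proof.
move=> kn; rewrite /root_poly (bigD1 (Ordinal kn))//= derivM derivXsubC mul1r.
rewrite hornerD hornerM hornerXsubC subrr mul0r addr0 horner_prod.
apply/prodf_neq0 => i ik; rewrite hornerXsubC subr_eq0 eqr_nat eq_sym.
by apply: contra ik => /eqP ik; apply/eqP/val_inj.
Qed.

End LocalInverse.

Section Trigo.
Variable R : realType.

Lemma cos_sin_2pi_int (x : R) (k : int) :
  cos (2 * pi * (x + k%:~R)) = cos (2 * pi * x) /\
  sin (2 * pi * (x + k%:~R)) = sin (2 * pi * x).
Proof.
have nat (y : R) (n : nat) : cos (2 * pi * (y + n%:R)) = cos (2 * pi * y) /\
    sin (2 * pi * (y + n%:R)) = sin (2 * pi * y).
  rewrite mulrDr (_ : 2 * pi * n%:R = pi *+ 2 *+ n).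
    by rewrite (periodicn (@cosD2pi R)) (periodicn (@sinD2pi R)).
  by rewrite -[RHS]mulr_natr -[pi *+ 2]mulr_natl.
case: k => n; first exact: nat.
have := nat (x + (Negz n)%:~R) n.+1.
by rewrite NegzE mulrNz subrK => -[-> ->].
Qed.

(** The fractional part [z] of [y - x] satisfies [1 = cos (2 pi z) = 1 - 2 sin (pi z)^2], and
    [sin (pi z) > 0] for [0 < z < 1]. *)
Lemma cos_sin_2pi_inj (x y : R) : cos (2 * pi * x) = cos (2 * pi * y) ->
  sin (2 * pi * x) = sin (2 * pi * y) -> exists k : int, y = x + k%:~R.
Proof.
move=> cxy sxy; exists (Num.floor (y - x)).
set k := Num.floor _; pose z := y - x - k%:~R.
have z01 : 0 <= z < 1.
  rewrite /z subr_ge0 floor_le//= ltrBlDr [ltRHS]addrC -intrD1.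
  by case/andP: (floor_itv (y - x)).
have cz : cos (2 * pi * z) = 1.
  have [<- _] := cos_sin_2pi_int z k; rewrite /z subrK mulrBr cosB cxy sxy.
  by rewrite -!expr2 cos2Dsin2.
suff z0 : z = 0 by move: z0; rewrite /z; lra.
apply/eqP; rewrite eq_le; case/andP: z01 => -> z1; rewrite andbT leNgt.
apply/negP => z0.
have s0 : 0 < sin (pi * z).
  by apply: sin_gt0_pi; rewrite mulr_gt0 ?pi_gt0//= gtr_pMr ?pi_gt0.
have : cos (2 * pi * z) = 1 - 2 * sin (pi * z) ^+ 2.
  rewrite -mulrA (_ : 2 * (pi * z) = (pi * z) *+ 2); last by rewrite -[RHS]mulr_natl.
  rewrite cos_mulr2n cos2sin2 -mulr_natl; lra.
have s20 : 0 < sin (pi * z) ^+ 2 by rewrite exprn_gt0.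
by rewrite cz; lra.
Qed.

End Trigo.

Section IsC1.
Variables (R : realType) (n : nat).
Implicit Types f : 'rV[R]_n -> R.

Definition isC1 f := exists g, C1 f g.

Lemma isC1_cst a : isC1 (cst a). Proof. by exists (cst 0); exact: C1_cst. Qed.

Lemma isC1_mul f1 f2 : isC1 f1 -> isC1 f2 -> isC1 (fun x => f1 x * f2 x).
Proof. by move=> [g1 G1] [g2 G2]; eexists; exact: C1_mul G1 G2. Qed.

Lemma isC1_comp f (phi dphi : R -> R) : isC1 f ->
  (forall x, is_derive (f x) 1 phi (dphi (f x))) ->
  continuous (fun x => dphi (f x)) -> isC1 (fun x => phi (f x)).
Proof. by move=> [g Gg] d c; eexists; exact: C1_comp Gg d c. Qed.

Lemma isC1_continuous f : isC1 f -> continuous f.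
Proof. by move=> [g Gg]; exact: C1_continuous Gg. Qed.

Lemma continuous_compR f (phi : R -> R) : continuous f ->
  (forall x, {for f x, continuous phi}) -> continuous (fun x => phi (f x)).
Proof.
by move=> fc pc x; apply: (@continuous_comp _ _ _ f phi); [exact: fc|exact: pc].
Qed.

Lemma C1_cos f g (w : R) : C1 f g ->
  C1 (fun x => cos (w * f x)) (fun x => (- w * sin (w * f x)) *: g x).
Proof.
move=> fg; apply: (@C1_comp _ _ f g (fun y => cos (w * y)) (fun y => - w * sin (w * y))) => //.
  by move=> x; apply: is_derive_eq; rewrite /GRing.scale /=; ring.
apply: (continuous_compR (phi := fun y => - w * sin (w * y))).
  exact: C1_continuous fg.
by move=> x; apply: derive_continuous; apply: is_deriveM.
Qed.

Lemma C1_sin f g (w : R) : C1 f g ->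
  C1 (fun x => sin (w * f x)) (fun x => (w * cos (w * f x)) *: g x).
Proof.
move=> fg; apply: (@C1_comp _ _ f g (fun y => sin (w * y)) (fun y => w * cos (w * y))) => //.
  by move=> x; apply: is_derive_eq; rewrite /GRing.scale /=; ring.
apply: (continuous_compR (phi := fun y => w * cos (w * y))).
  exact: C1_continuous fg.
by move=> x; apply: derive_continuous; apply: is_deriveM.
Qed.

Lemma C1_sqrt f g : C1 f g -> (forall x, 0 < f x) ->
  C1 (fun x => Num.sqrt (f x)) (fun x => (2 * Num.sqrt (f x))^-1 *: g x).
Proof.
move=> fg f0; apply: (@C1_comp _ _ f g Num.sqrt (fun y => (2 * Num.sqrt y)^-1)) => //.
  by move=> x; exact: is_derive1_sqrt.
apply: (continuous_compR (phi := fun y => (2 * Num.sqrt y)^-1)).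
  exact: C1_continuous fg.
move=> x; apply: continuousV; first by rewrite mulf_neq0// gt_eqF// sqrtr_gt0.
by apply: continuousM; [exact: cvg_cst|exact: sqrt_continuous].
Qed.

Lemma C1_horner f g (p : {poly R}) : C1 f g ->
  C1 (fun x => p.[f x]) (fun x => p^`().[f x] *: g x).
Proof.
move=> fg; apply: (C1_comp (phi := horner p) (dphi := horner p^`()) fg).
apply: continuous_compR; first exact: C1_continuous fg.
by move=> x; exact: continuous_horner.
Qed.

Lemma C1_exp f g : C1 f g -> C1 (fun x => expR (f x)) (fun x => expR (f x) *: g x).
Proof.
move=> fg; apply: (C1_comp (phi := expR) (dphi := expR) fg).
apply: continuous_compR; first exact: C1_continuous fg.
by move=> x; exact: continuous_expR.
Qed.

End IsC1.

Section EmbeddingOpen.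
Variables (R : realType) (d n : nat).

Lemma mx_continuous (T : topologicalType) m k (g : T -> 'M[R]_(m, k)) :
  (forall i j, continuous (fun x => g x i j)) -> continuous g.
Proof.
move=> gc x; apply/cvgrPdist_le => e e0; near=> y.
rewrite [leLHS]/Num.Def.normr/= mx_normrE (bigmax_le _ (ltW e0))//= => ij _.
rewrite !mxE; move: ij; near: y; apply: filter_forall => -[i j] /=.
by have /cvgrPdist_le/(_ e e0) := gc i j x.
Unshelve. all: by end_near. Qed.

(** Let [W] be the union of the integer translates of [U]. The part of the unit cube outside [W] is
    compact, hence its image is closed, and the complement of that image is the required [V]. *)
Lemma torus_quotient_open (h : 'rV[R]_d -> 'rV[R]_n) : continuous h ->
  (forall x y, h x = h y <-> exists k : 'rV[int]_d, y = x + map_mx intr k) ->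
  forall U : set 'rV[R]_d, open U ->
    exists2 V : set 'rV[R]_n, open V & h @` U = range h `&` V.
Proof.
move=> hc hE U Uo.
pose W := \bigcup_(k in [set: 'rV[int]_d]) ((fun x : 'rV[R]_d => x + map_mx intr k) @^-1` U).
have Wo : open W.
  apply: bigcup_open => k _; apply: open_comp => // x _.
  apply: differentiable_continuous; exact: (differentiableD (f := id) (g := cst _)).
have Kc : compact (@unit_cube R d `&` ~` W).
  apply: compact_closedI; first exact: (@unit_cube_compact R d).
  exact: open_closedC.
have hKc : compact (h @` (@unit_cube R d `&` ~` W)).
  apply: continuous_compact => //; exact: continuous_subspaceT.
exists (~` (h @` (@unit_cube R d `&` ~` W))).
  apply: closed_openC; apply: compact_closed => //; exact: norm_hausdorff.
apply/seteqP; split=> [_ [u Uu <-]|y [[x _ <-] nK]].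
  split=> [|[x [_ nW] xu]]; first by exists u.
  by have /hE[k uE] := xu; apply: nW; exists k => //=; rewrite -uE.
have [k [y' yc xE]] := unit_cube_floor x.
have hxy : h y' = h x by apply/hE; exists k.
have [[k' _ Uy]|nW] := pselect (W y').
  by exists (y' + map_mx intr k') => //; rewrite -hxy; apply/esym/hE; exists k'.
by exfalso; apply: nK; exists y'.
Qed.

End EmbeddingOpen.

(** * Angle coordinates on the zero set of the tower *)

Section TowerTorus.
Variables (R : realType) (d : nat).
Variable e : nat -> R.
Hypothesis e_gt0 : forall i, 0 < e i.
Hypothesis e_decr : forall i, 2 * e i.+1 < e i ^+ 2.

(** Natural number indices, with value [0] from [d] on, let the recursion on the tower index avoid
    ordinals. *)
Definition angle (i : nat) (t : 'rV[R]_d) : R := oapp (t 0) 0 (insub i).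

Lemma angleE (i : 'I_d) t : angle i t = t 0 i.
Proof. by rewrite /angle valK. Qed.

Definition angle_grad (i : nat) : 'rV[R]_d := oapp (delta_mx 0) 0 (insub i).

Lemma C1_angle i : C1 (angle i) (cst (angle_grad i)).
Proof.
rewrite /angle /angle_grad; case: insubP => [j _ _|_] /=; first exact: C1_coord.
exact: C1_cst.
Qed.

(* [depth_level k t] is the value of the tower function of index [d - k]. *)
Fixpoint depth_level (k : nat) (t : 'rV[R]_d) : R :=
  if k is k'.+1 then
    Num.sqrt (e (d - k) + depth_level k' t) * cos (2 * pi * angle (d - k) t)
  else 0.

(** This is [H_i] on the torus. In polar coordinates [H_i = r_i cos] and [y_(i+1) = r_i sin] of the
    [i]-th angle, where [r_i^2 = H_i^2 + y_(i+1)^2 = e_i + H_(i+1)]; [r_i] is [radius] and [y_j] is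
    [tube_coord]. *)
Definition level i := depth_level (d - i).

Definition radius i t := Num.sqrt (e i + level i.+1 t).

Lemma level_top t : level d t = 0.
Proof. by rewrite /level subnn. Qed.

Lemma levelE i t : (i < d)%N -> level i t = radius i t * cos (2 * pi * angle i t).
Proof.
move=> id; have E1 : (d - i = (d - i.+1).+1)%N by rewrite subnSK.
have E2 : (d - (d - i.+1).+1 = i)%N by rewrite -E1 subKn// ltnW.
by rewrite /level E1 /= E2.
Qed.

(** Descending induction from [H_d = 0]: [H_(i+1)^2 <= e_(i+1) + H_(i+2) < 2 e_(i+1) < e_i^2]. This
    is what [e_decr] is made for. *)
Lemma level_lt i t : (i < d)%N -> `|level i.+1 t| < e i.
Proof.
move=> id; have [m mE] : exists m, (i + m.+1 = d)%N by exists (d - i.+1)%N; lia.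
elim: m i mE {id} => [|m IH] i im.
  by rewrite (_ : i.+1 = d) ?level_top ?normr0//; lia.
have id : (i.+1 < d)%N by lia.
have := IH i.+1; rewrite addSnnS => /(_ im); rewrite ltr_norml => /andP[l1 l2].
rewrite levelE// -(ltr_pXn2r (n := 2))// ?nnegrE ?ltW//.
apply: le_lt_trans (e_decr i); rewrite real_normK ?num_real// exprMn.
rewrite sqr_sqrtr; last by lra.
have c1 : cos (2 * pi * angle i.+1 t) ^+ 2 <= 1.
  by rewrite cos2sin2 gerBl sqr_ge0.
apply: le_trans (_ : _ <= (e i.+1 + level i.+2 t) * 1) _; last by lra.
by rewrite ler_wpM2l//; lra.
Qed.

Lemma radius_sqr_gt0 i t : (i < d)%N -> 0 < e i + level i.+1 t.
Proof. by move=> /level_lt-/(_ t); rewrite ltr_norml => /andP[]; lra. Qed.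

Lemma radius_gt0 i t : (i < d)%N -> 0 < radius i t.
Proof. by move=> id; rewrite sqrtr_gt0 radius_sqr_gt0. Qed.

Lemma radius_sqr i t : (i < d)%N -> radius i t ^+ 2 = e i + level i.+1 t.
Proof. by move=> id; apply: sqr_sqrtr; exact: ltW (radius_sqr_gt0 t id). Qed.

Variables (a : R) (p : nat -> {poly R}) (psi : nat -> R -> R).
Hypothesis e_small : forall i, 2 * e i < a ^+ 2.
Hypothesis a_gt0 : 0 < a.
Hypothesis psi_inverse : forall j, (j <= d)%N -> forall y, `|y| < a ->
  [/\ (p j).[psi j y] = y, (p j)^`().[psi j y] != 0 &
      is_derive y (1 : R) (psi j) ((p j)^`().[psi j y])^-1].

Lemma radius_lt i t : (i < d)%N -> radius i t < a.
Proof.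
move=> id; rewrite -(ltr_pXn2r (n := 2))// ?nnegrE ?ltW ?radius_gt0//.
rewrite radius_sqr//; have := level_lt t id; have := e_small i.
by rewrite ltr_norml => ? /andP[]; lra.
Qed.

Definition tube_coord j t :=
  if j is i.+1 then radius i t * sin (2 * pi * angle i t) else level 0 t.

Lemma tube_coord_lt j t : (j <= d)%N -> `|tube_coord j t| < a.
Proof.
have bound i (c : R) : (i < d)%N -> `|c| <= 1 -> `|radius i t * c| < a.
  move=> id c1; rewrite normrM; apply: le_lt_trans (radius_lt t id).
  by rewrite (gtr0_norm (radius_gt0 t id)) ler_piMr// ltW// radius_gt0.
case: j => [_|i id]; last exact: bound (sin_max _).
have [d0|d0] := posnP d; last by rewrite /= levelE//; exact: bound (cos_max _).
by rewrite /= -d0 level_top normr0.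
Qed.

Definition torus_map (t : 'rV[R]_d) : 'rV[R]_d.+1 :=
  \row_(j < d.+1) psi j (tube_coord j t).

Fixpoint tower i (x : 'rV[R]_d.+1) : R :=
  if i is i'.+1 then tower i' x * tower i' x +
    (p i).[x 0 (inord i)] * (p i).[x 0 (inord i)] + - e i'
  else (p 0%N).[x 0 (inord 0)].

Lemma torus_map_coord j t : (j <= d)%N ->
  (p j).[torus_map t 0 (inord j)] = tube_coord j t.
Proof.
move=> jd; rewrite mxE inordK//.
by have [->] := psi_inverse jd (tube_coord_lt t jd).
Qed.

Lemma tower_torus_map i t : (i <= d)%N -> tower i (torus_map t) = level i t.
Proof.
elim: i => [_|i IH id]; first by rewrite /= (torus_map_coord t (leq0n d)).
rewrite [LHS]/= IH ?(ltnW id)// torus_map_coord// levelE//=.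
rewrite -!expr2 !exprMn -mulrDr cos2Dsin2 mulr1 radius_sqr//; lra.
Qed.

Fixpoint tower_grad i (x : 'rV[R]_d.+1) : 'rV[R]_d.+1 :=
  if i is i'.+1 then (2 * tower i' x) *: tower_grad i' x +
    (2 * ((p i).[x 0 (inord i)] * (p i)^`().[x 0 (inord i)])) *: delta_mx 0 (inord i)
  else (p 0%N)^`().[x 0 (inord 0)] *: delta_mx 0 (inord 0).

Lemma C1_horner_coord (q : {poly R}) n (i : 'I_n) :
  C1 (fun x : 'rV[R]_n => q.[x 0 i]) (fun x => q^`().[x 0 i] *: delta_mx 0 i).
Proof. exact: (C1_horner q (C1_coord R i)). Qed.

Lemma C1_eq n (f : 'rV[R]_n -> R) g g' : C1 f g -> g = g' -> C1 f g'.
Proof. by move=> fg <-. Qed.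

Lemma C1_tower i : C1 (tower i) (tower_grad i).
Proof.
elim: i => [|i IH]; first exact: C1_horner_coord.
have cp := C1_horner_coord (p i.+1) (inord i.+1 : 'I_d.+1).
have := C1_add (C1_add (C1_mul IH IH) (C1_mul cp cp)) (C1_cst _ (- e i)).
move/C1_eq; apply; apply/funext => x /=.
by rewrite addr0 scalerA -!scalerDl; congr (_ *: _ + _ *: _); rewrite /GRing.scale /=; ring.
Qed.

Lemma tower_grad_gt i (j : 'I_d.+1) x : (i < j)%N -> tower_grad i x 0 j = 0.
Proof.
have ne k : (k < j)%N -> (j == inord k :> 'I_d.+1) = false.
  move=> kj; have kd := ltn_trans kj (ltn_ord j).
  by apply/negbTE/eqP => jE; move: kj; rewrite jE inordK// ltnn.
elim: i => [|i IH] ij; rewrite !mxE; first by rewrite ne// andbF mulr0.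
by rewrite IH ?(ltnW ij)// ne// andbF !mulr0 addr0.
Qed.

(** If [y_(i+1)] is nonzero, the derivative in the new variable [x_(i+1)] is [2 y_(i+1)] times the
    nonzero derivative of [p_(i+1)]. If it vanishes, then so does the sine, hence the cosine and
    [H_i] do not, and the gradient is [2 H_i grad H_i]. *)
Lemma tower_grad_neq0 i t : (i <= d)%N ->
  exists2 j : 'I_d.+1, (j <= i)%N & tower_grad i (torus_map t) 0 j != 0.
Proof.
have p'n j : (j <= d)%N -> (p j)^`().[torus_map t 0 (inord j)] != 0.
  move=> jd; rewrite mxE inordK//.
  by have [_ ->] := psi_inverse jd (tube_coord_lt t jd).
elim: i => [_|i IH id].
  exists (inord 0); first by rewrite inordK.
  by rewrite [tower_grad _ _]/= mxE [X in _ * X]mxE !eqxx mulr1 p'n.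
have [Y0|Y0] := eqVneq (tube_coord i.+1 t) 0; last first.
  exists (inord i.+1); first by rewrite inordK.
  have ii : (i < (inord i.+1 : 'I_d.+1))%N by rewrite inordK.
  rewrite [tower_grad _ _]/= mxE [X in X + _]mxE [X in _ + X]mxE.
  rewrite [X in _ + _ * X]mxE (tower_grad_gt _ ii) mulr0 add0r !eqxx mulr1.
  by rewrite torus_map_coord// mulf_neq0 ?pnatr_eq0// mulf_neq0// p'n.
have [j ji gj] := IH (ltnW id); exists j; first exact: leqW.
rewrite [tower_grad _ _]/= mxE [X in X + _]mxE torus_map_coord// Y0 mul0r mulr0 scale0r.
rewrite [X in _ + X]mxE addr0 tower_torus_map ?(ltnW id)// !mulf_neq0 ?pnatr_eq0//.
have r0 := radius_gt0 t id.
rewrite levelE//; apply: mulf_neq0; first by rewrite gt_eqF.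
apply/eqP => c0.
have s0 : sin (2 * pi * angle i t) = 0.
  by move/eqP: Y0; rewrite /= mulf_eq0 gt_eqF//= => /eqP.
have := cos2Dsin2 (2 * pi * angle i t); rewrite c0 s0 expr0n/= addr0 => /eqP.
by rewrite eq_sym oner_eq0.
Qed.

Lemma isC1_level i : (i <= d)%N -> isC1 (level i).
Proof.
move=> id; have [m mE] : exists m, (i + m = d)%N by exists (d - i)%N; lia.
elim: m i mE {id} => [|m IH] i im.
  rewrite (_ : level i = cst 0); first exact: isC1_cst.
  by rewrite (_ : i = d); [apply/funext => t; rewrite level_top|lia].
have id : (i < d)%N by lia.
have [g Cg] : isC1 (level i.+1) by apply: IH; lia.
rewrite (_ : level i = fun t => radius i t * cos (2 * pi * angle i t)).
  apply: isC1_mul; last by eexists; exact: C1_cos (C1_angle i).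
  eexists; apply: (C1_sqrt (C1_add (C1_cst _ (e i)) Cg)) => t.
  exact: radius_sqr_gt0.
by apply/funext => t; rewrite levelE.
Qed.

Lemma C1_radius i g : (i < d)%N -> C1 (level i.+1) g ->
  C1 (radius i) (fun t => (2 * radius i t)^-1 *: g t).
Proof.
move=> id Cg; have := C1_sqrt (C1_add (C1_cst _ (e i)) Cg) (fun t => radius_sqr_gt0 t id).
by move/C1_eq; apply; apply/funext => t; rewrite add0r.
Qed.

Lemma isC1_tube_coord j : (j <= d)%N -> isC1 (tube_coord j).
Proof.
case: j => [_|i id]; first exact: isC1_level.
have [g Cg] := isC1_level id; apply: isC1_mul; first by eexists; exact: C1_radius Cg.
by eexists; exact: C1_sin (C1_angle i).
Qed.

Lemma isC1_torus_map (j : 'I_d.+1) : isC1 (fun t => torus_map t 0 j).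
Proof.
have jd : (j <= d)%N by rewrite -ltnS.
rewrite (_ : (fun t => _) = fun t => psi j (tube_coord j t)); last first.
  by apply/funext => t; rewrite mxE.
have dpsi t : is_derive (tube_coord j t) (1 : R) (psi j)
    ((p j)^`().[psi j (tube_coord j t)])^-1.
  by have [] := psi_inverse jd (tube_coord_lt t jd).
apply: (isC1_comp (dphi := fun y => ((p j)^`().[psi j y])^-1)) => //.
  exact: isC1_tube_coord.
apply: (continuous_compR (phi := fun y => ((p j)^`().[psi j y])^-1)).
  exact/isC1_continuous/isC1_tube_coord.
move=> t; apply: continuousV.
  by have [] := psi_inverse jd (tube_coord_lt t jd).
apply: (@continuous_comp _ _ _ (psi j) (horner (p j)^`())).
  exact: derive_continuous (dpsi t).
exact: continuous_horner.
Qed.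
Lemma angle_int i (t : 'rV[R]_d) (k : 'rV[int]_d) :
  angle i (t + map_mx intr k) = angle i t + (oapp (k 0) 0 (insub i))%:~R.
Proof. by rewrite /angle; case: insubP => [j _ _|_] /=; rewrite ?mxE ?addr0. Qed.

Lemma depth_level_periodic k : torus_periodic (depth_level k).
Proof.
elim: k => [//|k IH] t z /=; rewrite IH angle_int.
by have [-> _] := cos_sin_2pi_int (angle (d - k.+1) t) (oapp (z 0) 0 (insub (d - k.+1)%N)).
Qed.

Lemma tube_coord_periodic j : torus_periodic (tube_coord j).
Proof.
case: j => [|i] t z /=; first exact: depth_level_periodic.
rewrite /radius /level depth_level_periodic angle_int.
by have [_ ->] := cos_sin_2pi_int (angle i t) (oapp (z 0) 0 (insub i)).
Qed.

(** A point of the torus determines all [H_i] and [y_j], hence the radii, and then the sine and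
    cosine of each angle. *)
Lemma torus_map_eqP x y :
  torus_map x = torus_map y <-> exists k : 'rV[int]_d, y = x + map_mx intr k.
Proof.
split=> [xy|[k ->]]; last first.
  by apply/rowP => j; rewrite !mxE tube_coord_periodic.
have lev i : (i <= d)%N -> level i x = level i y.
  by move=> id; rewrite -!tower_torus_map// xy.
have tub j : (j <= d)%N -> tube_coord j x = tube_coord j y.
  by move=> jd; rewrite -!torus_map_coord// xy.
have ang (i : 'I_d) : exists k : int, y 0 i = x 0 i + k%:~R.
  rewrite -!angleE; have id := ltn_ord i.
  have rE : radius i x = radius i y by rewrite /radius lev.
  have r0 : radius i y != 0 by rewrite gt_eqF// radius_gt0.
  have := lev i (ltnW id); rewrite !levelE// rE => /(mulfI r0) cE.
  have := tub i.+1 id; rewrite /= rE => /(mulfI r0) sE.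
  exact: cos_sin_2pi_inj.
exists (\row_i projT1 (cid (ang i))).
by apply/rowP => i; rewrite !mxE; case: (cid _).
Qed.

Lemma torus_map_differentiable t : differentiable torus_map t.
Proof.
by apply: differentiable_row => j; have [g Cg] := isC1_torus_map j; exact: C1_differentiable Cg.
Qed.

Lemma diff_torus_map_eq0 t u (f : 'rV[R]_d.+1 -> R) g g' :
  'd torus_map t u = 0 -> C1 f g -> C1 (fun t => f (torus_map t)) g' ->
  dot (g' t) u = 0.
Proof.
move=> du Cf Cg; rewrite -(C1_diff t u Cg).
have fd := C1_differentiable (torus_map t) Cf.
have := diff_comp (torus_map_differentiable t) fd => /(congr1 (fun k => k u)) /= ->.
by rewrite du linear0.
Qed.

(** The functions [level] and [tube_coord] factor through [torus_map], so their differentials vanish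
    on its kernel, and so do those of the radii. In [r cos] and [r sin] only the angular terms
    remain; as sine and cosine are not both zero, each angular component is zero. *)
Lemma diff_torus_map_inj t : injective ('d torus_map t).
Proof.
suff ker u : 'd torus_map t u = 0 -> u = 0.
  by move=> u v uv; apply/subr0_eq/ker; rewrite linearB /= uv subrr.
move=> du; apply/rowP => i; rewrite [RHS]mxE; have id := ltn_ord i.
have level_ker j g : (j <= d)%N -> C1 (level j) g -> dot (g t) u = 0.
  move=> jd Cg; apply: (diff_torus_map_eq0 du (C1_tower j)).
  rewrite (_ : (fun t => _) = level j)//.
  by apply/funext => s; rewrite tower_torus_map.
have tube_ker j g : (j <= d)%N -> C1 (tube_coord j) g -> dot (g t) u = 0.
  move=> jd Cg.
  apply: (diff_torus_map_eq0 du (C1_horner_coord (p j) (inord j : 'I_d.+1))).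
  rewrite (_ : (fun t => _) = tube_coord j)//.
  by apply/funext => s; rewrite torus_map_coord.
have [g Cg] := isC1_level (id : (i.+1 <= d)%N).
have Cr := C1_radius id Cg.
have rk := level_ker _ _ id Cg.
have r0 := radius_gt0 t id.
have Ca := C1_angle i.
have au : dot (angle_grad i) u = u 0 i.
  by rewrite /angle_grad valK /= dotC dot_delta.
have w0 : 2 * pi != 0 :> R by rewrite mulf_neq0// gt_eqF// pi_gt0.
have levelC : level i = fun t => radius i t * cos (2 * pi * angle i t).
  by apply/funext => s; rewrite levelE.
have := C1_mul Cr (C1_cos (2 * pi) Ca); rewrite -levelC.
move/(level_ker _ _ (ltnW id)); rewrite dotDl !dotZl rk !mulr0 addr0 au.
have := C1_mul Cr (C1_sin (2 * pi) Ca).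
move/(tube_ker i.+1 _ id); rewrite dotDl !dotZl rk !mulr0 addr0 au => /eqP cu /eqP su.
move: cu; rewrite mulf_eq0 (gt_eqF r0) /= mulf_eq0 mulf_eq0 (negbTE w0) /=.
move: su; rewrite mulf_eq0 (gt_eqF r0) /= mulf_eq0 mulf_eq0 oppr_eq0 (negbTE w0) /=.
case/orP => [/eqP c0|/eqP//]; case/orP => [/eqP s0|/eqP//].
have := cos2Dsin2 (2 * pi * angle i t); rewrite c0 s0 expr0n/= addr0 => /eqP.
by rewrite eq_sym oner_eq0.
Qed.

Theorem torus_map_embedding : torus_embedding torus_map.
Proof.
split.
- exact: torus_map_eqP.
- exact: torus_map_differentiable.
- apply: mx_continuous => i j; have [g Cg] := isC1_torus_map j.
  rewrite (_ : (fun x => _) = fun x => g x 0 i).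
    move=> x; apply: (@continuous_comp _ _ _ g (fun v : 'rV[R]_d => v 0 i)).
      exact: (proj2 Cg x).
    exact: continuous_coord.
  apply/funext => x; have dx := torus_map_differentiable x.
  by rewrite mxE (diff_row _ _ dx) (C1_diff _ _ Cg) dot_delta.
- exact: diff_torus_map_inj.
- apply: torus_quotient_open; last exact: torus_map_eqP.
  by move=> x; exact/differentiable_continuous/torus_map_differentiable.
Qed.

End TowerTorus.

(** * Gradient fields *)

Section LocallyLipschitz.
Variables (R : realType) (n : nat).
Implicit Types (f g : 'rV[R]_n -> R).

Lemma locally_lipschitz_bounded f : locally_lipschitz f ->
  forall B : R, exists2 C : R, 0 <= C & forall x, `|x| <= B -> `|f x| <= C.
Proof.
move=> fL B; have [L L0 fB] := fL `|B|.
exists (L * `|B| + `|f 0|); first by rewrite addr_ge0// mulr_ge0// ltW.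
move=> x xB; have xB' := le_trans xB (ler_norm B).
rewrite -(subrK (f 0) (f x)); apply: le_trans (ler_normD _ _) _; rewrite lerD2r.
apply: le_trans (fB x 0 xB' _) _; first by rewrite normr0.
by rewrite subr0 ler_wpM2l// ltW.
Qed.

Lemma locally_lipschitz_cst (a : R) : locally_lipschitz (fun _ : 'rV[R]_n => a : R).
Proof.
by move=> B; exists 1 => // x y _ _; rewrite subrr normr0 mul1r.
Qed.

Lemma locally_lipschitz_coord i : locally_lipschitz (fun x : 'rV[R]_n => x 0 i).
Proof.
move=> B; exists 1 => // x y _ _; rewrite mul1r.
by have := coord_le_norm (x - y) i; rewrite !mxE.
Qed.

Lemma locally_lipschitz_add f g : locally_lipschitz f -> locally_lipschitz g ->
  locally_lipschitz (fun x => f x + g x).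
Proof.
move=> fL gL B; have [L L0 fB] := fL B; have [M M0 gB] := gL B.
exists (L + M); first exact: addr_gt0.
move=> x y xB yB; rewrite opprD addrACA mulrDl; apply: le_trans (ler_normD _ _) _.
by rewrite lerD ?fB ?gB.
Qed.

Lemma locally_lipschitz_mul f g : locally_lipschitz f -> locally_lipschitz g ->
  locally_lipschitz (fun x => f x * g x).
Proof.
move=> fL gL B; have [L L0 fB] := fL B; have [M M0 gB] := gL B.
have [C C0 fC] := locally_lipschitz_bounded fL B.
have [D D0 gD] := locally_lipschitz_bounded gL B.
exists (C * M + D * L + 1).
  by rewrite ltr_wpDl// addr_ge0// mulr_ge0// ltW.
move=> x y xB yB.
have -> : f x * g x - f y * g y = f x * (g x - g y) + g y * (f x - f y) by ring.
apply: le_trans (ler_normD _ _) _; rewrite !normrM.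
apply: (@le_trans _ _ (C * (M * `|x - y|) + D * (L * `|x - y|))).
  by apply: lerD; apply: ler_pM; rewrite ?fC ?gD ?fB ?gB.
by rewrite !mulrA -mulrDl ler_wpM2r// lerDl.
Qed.

Lemma locally_lipschitz_sum (I : Type) (r : seq I) (f : I -> 'rV[R]_n -> R) :
  (forall i, locally_lipschitz (f i)) ->
  locally_lipschitz (fun x => \sum_(i <- r) f i x).
Proof.
move=> fL; elim: r => [|i r IH].
  by under eq_fun do rewrite big_nil; exact: locally_lipschitz_cst.
by under eq_fun do rewrite big_cons; exact: locally_lipschitz_add.
Qed.

Lemma locally_lipschitz_prod (I : Type) (r : seq I) (f : I -> 'rV[R]_n -> R) :
  (forall i, locally_lipschitz (f i)) ->
  locally_lipschitz (fun x => \prod_(i <- r) f i x).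
Proof.
move=> fL; elim: r => [|i r IH].
  by under eq_fun do rewrite big_nil; exact: locally_lipschitz_cst.
by under eq_fun do rewrite big_cons; exact: locally_lipschitz_mul.
Qed.

Lemma locally_lipschitz_exp f k : locally_lipschitz f ->
  locally_lipschitz (fun x => f x ^+ k).
Proof.
move=> fL; elim: k => [|k IH]; first exact: locally_lipschitz_cst.
by under eq_fun do rewrite exprS; exact: locally_lipschitz_mul.
Qed.

Lemma locally_lipschitz_row m (F : 'rV[R]_n -> 'rV[R]_m) :
  (forall i, locally_lipschitz (fun x => F x 0 i)) -> locally_lipschitz F.
Proof.
move=> FL B; pose L i := s2val (cid2 (FL i B)).
have L0 i : 0 < L i by exact: s2valP (cid2 (FL i B)).
exists (1 + \sum_i L i).
  by rewrite ltr_pwDl// sumr_ge0// => i _; exact: ltW.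
move=> x y xB yB; apply: norm_le_coord => [|i].
  by rewrite mulr_ge0// addr_ge0// sumr_ge0// => i _; exact: ltW.
rewrite !mxE; apply: le_trans (s2valP' (cid2 (FL i B)) x y xB yB) _.
rewrite ler_wpM2r// (bigD1 i)//= addrCA lerDl addr_ge0// sumr_ge0// => j _.
exact: ltW.
Qed.

End LocallyLipschitz.

(** * Polynomial functions and their degrees *)

Section PolynomialFunctions.
Variables (R : realType) (n : nat).
Implicit Types (f g : 'rV[R]_n -> R) (k : nat).

Definition polyfun k f := exists2 P : mpoly n R,
  (msize P <= k.+1)%N & forall x, f x = meval (fun j => x 0 j) P.

Lemma polyfunW k l f : (k <= l)%N -> polyfun k f -> polyfun l f.
Proof. by move=> kl [P Pk fE]; exists P => //; apply: leq_trans Pk _. Qed.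

Lemma polyfun_cst k (a : R) : polyfun k (fun=> a).
Proof.
exists (mpolyC n a) => [|x]; last by rewrite mevalC.
by rewrite mmeasureC; case: (a == 0).
Qed.

Lemma polyfun_add k f g : polyfun k f -> polyfun k g -> polyfun k (fun x => f x + g x).
Proof.
move=> [P Pk fE] [Q Qk gE]; exists (P + Q) => [|x]; last by rewrite mevalD fE gE.
by apply: leq_trans (mmeasureD_le _ _ _) _; rewrite geq_max Pk.
Qed.

Lemma polyfun_mul k l f g : polyfun k f -> polyfun l g ->
  polyfun (k + l) (fun x => f x * g x).
Proof.
move=> [P Pk fE] [Q Ql gE]; exists (P * Q) => [|x]; last by rewrite mevalM fE gE.
have [->|P0] := eqVneq P 0; first by rewrite mul0r msize0.
have [->|Q0] := eqVneq Q 0; first by rewrite mulr0 msize0.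
rewrite msizeM//; move: Pk Ql; move: (mmeasure _ P) (mmeasure _ Q) => u v; lia.
Qed.

Lemma polyfun_coord i : polyfun 1 (fun x => x 0 i).
Proof.
exists (mpolyX R (mnm1 i)) => [|x]; last by rewrite mevalXU.
by rewrite msizeX mdeg1.
Qed.

Lemma polyfun_exp k l f : polyfun k f -> polyfun (l * k) (fun x => f x ^+ l).
Proof.
move=> fk; elim: l => [|l IH]; first exact: polyfun_cst.
by under eq_fun do rewrite exprS; rewrite mulSn; exact: polyfun_mul.
Qed.

Lemma polyfun_sum k (I : Type) (r : seq I) (f : I -> 'rV[R]_n -> R) :
  (forall i, polyfun k (f i)) -> polyfun k (fun x => \sum_(i <- r) f i x).
Proof.
move=> fk; elim: r => [|i r IH].
  by under eq_fun do rewrite big_nil; exact: polyfun_cst.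
by under eq_fun do rewrite big_cons; exact: polyfun_add.
Qed.

Lemma polyfun_horner (q : {poly R}) k i : (size q <= k.+1)%N ->
  polyfun k (fun x => q.[x 0 i]).
Proof.
move=> qk; under eq_fun do rewrite horner_coef.
apply: polyfun_sum => j; rewrite -[k]add0n; apply: polyfun_mul.
  exact: polyfun_cst.
apply: (polyfunW (k := j * 1)).
  by rewrite muln1 -ltnS (leq_trans (ltn_ord j)).
by apply: polyfun_exp; exact: polyfun_coord.
Qed.

Lemma polyfun_locally_lipschitz k f : polyfun k f -> locally_lipschitz f.
Proof.
move=> [P _ fE]; rewrite (funext fE); under eq_fun do rewrite mevalE.
apply: locally_lipschitz_sum => m; apply: locally_lipschitz_mul.
  exact: locally_lipschitz_cst.
apply: locally_lipschitz_prod => i; apply: locally_lipschitz_exp.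
exact: locally_lipschitz_coord.
Qed.

Lemma polyfun_field k (F : 'rV[R]_n -> 'rV[R]_n) :
  (forall i, polyfun k (fun x => F x 0 i)) ->
  exists2 P : 'I_n -> mpoly n R, (field_degree P <= k)%N & poly_field P = F.
Proof.
move=> Fk; pose P i := s2val (cid2 (Fk i)); exists P.
  apply/bigmax_leqP => i _; have := s2valP (cid2 (Fk i)); rewrite -/(P i).
  by move: (mmeasure _ _) => u; lia.
apply/funext => x; apply/rowP => i; rewrite mxE.
by rewrite (s2valP' (cid2 (Fk i)) x).
Qed.

End PolynomialFunctions.

Section TowerPolynomials.
Variables (R : realType) (d N : nat) (nn : nat -> nat) (e : nat -> R).
Hypothesis nn0 : (nn 0 <= N)%N.
Hypothesis nnS : forall i, (i < d)%N -> (nn i.+1 <= 2 ^ i * N)%N.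

Let p j := root_poly R (nn j).

Lemma polyfun_root_poly j k (i : 'I_d.+1) : (nn j <= k)%N ->
  polyfun k (fun x : 'rV[R]_d.+1 => (p j).[x 0 i]).
Proof. by move=> jk; apply: polyfun_horner; rewrite size_root_poly ltnS. Qed.

Lemma polyfun_root_poly_deriv j k (i : 'I_d.+1) : (nn j <= k.+1)%N ->
  polyfun k (fun x : 'rV[R]_d.+1 => (p j)^`().[x 0 i]).
Proof.
move=> jk; apply: polyfun_horner; have := lt_size_deriv (p := p j).
rewrite -size_poly_eq0 size_root_poly => /(_ isT); lia.
Qed.

(** The condition on [nn] is that [y_(i+1)] has at most the degree of the bound for [H_i], so
    squaring both doubles that bound. *)
Lemma polyfun_tower i : (i <= d)%N -> polyfun (2 ^ i * N) (@tower R d e p i).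
Proof.
elim: i => [_|i IH id]; first by apply: polyfun_root_poly; rewrite mul1n.
have {}IH := IH (ltnW id); have := nnS id => ni.
rewrite expnS -mulnA mul2n -addnn; apply: polyfun_add; last exact: polyfun_cst.
apply: polyfun_add; apply: polyfun_mul => //; exact: polyfun_root_poly.
Qed.

Lemma polyfun_tower_grad i j : (i <= d)%N ->
  polyfun (2 ^ i * N) (fun x => @tower_grad R d e p i x 0 j).
Proof.
elim: i => [_|i IH id].
  under eq_fun do rewrite !mxE; rewrite -[(_ * _)%N]addn0.
  apply: polyfun_mul; last exact: polyfun_cst.
  by apply: polyfun_root_poly_deriv; rewrite mul1n leqW.
have {}IH := IH (ltnW id); have := nnS id => ni.
rewrite (_ : (fun x => _) = fun x : 'rV[R]_d.+1 =>
    2 * @tower R d e p i x * @tower_grad R d e p i x 0 j +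
    2 * ((p i.+1).[x 0 (inord i.+1)] * (p i.+1)^`().[x 0 (inord i.+1)]) *
      (delta_mx 0 (inord i.+1) : 'rV[R]_d.+1) 0 j); last first.
  by apply/funext => x /=; rewrite mxE [X in X + _]mxE [X in _ + X]mxE.
rewrite expnS -mulnA mul2n -addnn; apply: polyfun_add.
  apply: polyfun_mul => //; rewrite -[X in polyfun X]add0n.
  by apply: polyfun_mul; [exact: polyfun_cst|apply: polyfun_tower; exact: ltnW].
rewrite -[X in polyfun X]addn0; apply: polyfun_mul; last exact: polyfun_cst.
rewrite -[X in polyfun X]add0n; apply: polyfun_mul; first exact: polyfun_cst.
apply: polyfun_mul; first exact: polyfun_root_poly.
by apply: polyfun_root_poly_deriv; apply: leqW.
Qed.

Definition gradient_field (x : 'rV[R]_d.+1) : 'rV[R]_d.+1 :=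
  - @tower R d e p d x *: @tower_grad R d e p d x.

Lemma polyfun_gradient_field j : polyfun (2 ^ d.+1 * N) (fun x => gradient_field x 0 j).
Proof.
under eq_fun do rewrite mxE -mulN1r; rewrite expnS -mulnA mul2n -addnn.
apply: polyfun_mul; last exact: polyfun_tower_grad.
by rewrite -[X in polyfun X]add0n; apply: polyfun_mul;
  [exact: polyfun_cst|exact: polyfun_tower].
Qed.

End TowerPolynomials.

Lemma equilibrium_flows_to (R : realType) n (F : 'rV[R]_n -> 'rV[R]_n) x (t : R) :
  F x = 0 -> flows_to F t x x.
Proof. by move=> Fx; exists (cst x); split=> // s _; rewrite Fx; exact: is_derive_cst. Qed.

(* The tower function [G] vanishes on the torus and [F = - G grad G], so the torus
   consists of equilibria, with normal rate [- |grad G|^2]. *)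
Theorem gradient_torus (R : realType) (r d N : nat) (nn : nat -> nat) (e : nat -> R)
    (a : R) (psi : nat -> R -> R) :
  (nn 0 <= N)%N -> (forall i, (i < d)%N -> (nn i.+1 <= 2 ^ i * N)%N) ->
  (forall i, 0 < e i) -> (forall i, 2 * e i.+1 < e i ^+ 2) ->
  (forall i, 2 * e i < a ^+ 2) -> 0 < a ->
  (forall j, (j <= d)%N -> forall y, `|y| < a ->
    [/\ (root_poly R (nn j)).[psi j y] = y, (root_poly R (nn j))^`().[psi j y] != 0 &
      is_derive y (1 : R) (psi j) ((root_poly R (nn j))^`().[psi j y])^-1]) ->
  normally_hyperbolic_torus d r (@gradient_field R d nn e) (range (@torus_map R d e psi)).
Proof.
move=> nn0 nnS e0 eS ea a0 psiP; set F := gradient_field _ _; set h := torus_map _ _.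
have hh : torus_embedding h := torus_map_embedding e0 eS ea a0 psiP.
have Gh s : tower e (fun j => root_poly R (nn j)) d (h s) = 0.
  by rewrite (tower_torus_map e0 eS ea a0 psiP)// level_top.
have Fh s : F (h s) = 0 by rewrite /F /gradient_field Gh oppr0 scale0r.
exists h; split=> //.
  by move=> t _ [s _ <-]; exists (h s); [exact: equilibrium_flows_to|exists s].
left; pose g := @tower_grad R d e (fun j => root_poly R (nn j)) d.
have gL j : polyfun (2 ^ d * N) (fun x => g x 0 j) by exact: polyfun_tower_grad.
apply: (@normal_hyperbolicity_criterion _ _ _ _ _ (fun _ s => s)
  (@tower R d e (fun j => root_poly R (nn j)) d) (fun x => - dot (g x) (g x)) g) => //.
- apply: locally_lipschitz_row => j; apply: polyfun_locally_lipschitz.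
  exact: (@polyfun_gradient_field R d N nn e nn0 nnS j).
- by move=> s t; rewrite Fh; exact: is_derive_cst.
- move=> rho rho0; exists 1 => // t s s'; rewrite mul1r ler_peMl// -expR0 ler_expR.
  by rewrite mulr_ge0// ltW.
- exact: C1_tower.
- by move=> x; rewrite /F /gradient_field dotZr -/g; ring.
- apply: (@polyfun_locally_lipschitz _ _ (2 ^ d * N + 2 ^ d * N)).
  under eq_fun do rewrite -mulN1r.
  rewrite -[X in polyfun X]add0n; apply: polyfun_mul; first exact: polyfun_cst.
  by apply: polyfun_sum => j; exact: polyfun_mul.
- move=> s; have g0 : g (h s) != 0.
    have [j _] := tower_grad_neq0 e0 eS ea a0 psiP s (leqnn d).
    by apply: contra_neq => gE; have := congr1 (fun v : 'rV[R]_d.+1 => v 0 j) gE;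
      rewrite [X in _ = X]mxE.
  by split=> //; rewrite oppr_lt0 dot_gt0.
Qed.

(** * Rotating fields in dimension three *)

Section ShearFlow.
Variables (R : realType).

Lemma derive_lipschitz (f f' : R -> R) (C : R) :
  (forall s : R, is_derive s (1 : R) f (f' s)) -> (forall s, `|f' s| <= C) ->
  forall a b, `|f a - f b| <= C * `|a - b|.
Proof.
move=> df fC a b; wlog ba : a b / b <= a => [H|].
  by have [ba|/ltW ab] := leP b a; [|rewrite distrC (distrC a)]; exact: H.
have dg (s : R) : is_derive s (1 : R) (fun s : R => C * s) C.
  by apply: is_derive_eq; rewrite /GRing.scale /=; ring.
have := derive_norm_le ba (fun s _ => df s) (fun s _ => dg s) (fun s _ => fC s).
by rewrite -mulrBr (ger0_norm (x := a - b))// subr_ge0.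
Qed.

(* Writing the solution from [s] as [s + x(t) delta], the time function
   [S_s(x)] = integral of [1 / omega(s + y delta)] over [0 <= y <= x] satisfies
   [S_s(x(t)) = t]; comparing [S_s] and [S_s'] gives linear growth in [t]. *)
Lemma shear_flow n (om : 'rV[R]_n -> R) (delta : 'rV[R]_n) (L W m : R) :
  0 < L -> 0 < m -> `|delta| <= 1 ->
  (forall x y, `|om x - om y| <= L * `|x - y|) ->
  (forall x, m <= `|om x| <= W) ->
  exists Psi : R -> 'rV[R]_n -> 'rV[R]_n, [/\ forall s, Psi 0 s = s,
    forall s (t : R), is_derive t (1 : R) (fun t => Psi t s) (om (Psi t s) *: delta) &
    forall rho : R, 0 < rho -> exists2 C : R, 0 <= C & forall t s s',
      `|Psi t s - Psi t s'| <= C * expR (rho * `|t|) * `|s - s'|].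
Proof.
move=> L0 m0 d1 omL omb.
have W0 : 0 < W.
  by have /andP[h1 h2] := omb 0; apply: lt_le_trans m0 (le_trans h1 h2).
have om0 x : om x != 0.
  by rewrite -normr_gt0; have /andP[h1 _] := omb x; exact: lt_le_trans h1.
have omline s (x y : R) : `|om (s + x *: delta) - om (s + y *: delta)| <= L * `|x - y|.
  apply: le_trans (omL _ _) _; rewrite opprD addrACA subrr add0r -scalerBl normrZ.
  by rewrite ler_wpM2l ?ler_piMr// ltW.
have X s : exists2 x : R -> R, x 0 = 0 &
    forall t : R, is_derive t (1 : R) x (om (s + x t *: delta)).
  (* The scalar equation for the distance travelled along [delta], as a one-dimensional system. *)
  pose F (v : 'rV[R]_1) : 'rV[R]_1 := \row__ om (s + v 0 0 *: delta).
  have FL v w : `|F v - F w| <= L * `|v - w|.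
    apply: norm_le_coord => [|i]; first by rewrite mulr_ge0// ltW.
    rewrite !mxE; apply: le_trans (omline s _ _) _; rewrite (ler_wpM2l (ltW L0))//.
    by have := coord_le_norm (v - w) 0; rewrite !mxE.
  have [c c0 dc] := picard_lindelof L0 FL 0.
  exists (fun t => c t 0 0) => [|t]; first by rewrite c0 mxE.
  by have := is_derive_coord 0 (dc t); rewrite mxE.
pose x s := s2val (cid2 (X s)).
have x0 s : x s 0 = 0 by rewrite /x; case: (cid2 (X s)).
have dx s (t : R) : is_derive t (1 : R) (x s) (om (s + x s t *: delta)).
  by rewrite /x; case: (cid2 (X s)) => y /= _ /(_ t).
pose kap s y := (om (s + y *: delta))^-1.
have kapc s : continuous (kap s).
  move=> y; apply: continuousV; first exact: om0.
  exact: (lipschitz_continuous (omline s) (x := y)).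
pose S s := s2val (cid2 (primitive_exists (kapc s))).
have S0 s : S s 0 = 0 by rewrite /S; case: (cid2 _).
have dS s (y : R) : is_derive y (1 : R) (S s) (kap s y).
  by rewrite /S; case: (cid2 _) => z /= _ /(_ y).
have Sx s t : S s (x s t) = t.
  have dSx (u : R) : is_derive u (1 : R) (fun u => S s (x s u)) 1.
    have := is_derive1_comp (dS s (x s u)) (dx s u).
    by rewrite /kap mulVf.
  have h0 : Num.min 0 t <= 0 <= Num.max 0 t by rewrite ge_min lexx le_max lexx.
  have ht : Num.min 0 t <= t <= Num.max 0 t by rewrite ge_min lexx orbT le_max lexx orbT.
  apply: (eq_primitive h0 (fun u _ => dSx u) (fun u _ => is_derive_id u 1) _ ht).
  by rewrite x0 S0.
have xW s t : `|x s t| <= W * `|t|.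
  have := derive_lipschitz (dx s) (fun t => proj2 (andP (omb _))) t 0.
  by rewrite x0 !subr0.
have SW s a b : `|a - b| <= W * `|S s a - S s b|.
  wlog ab : a b / a < b => [H|].
    have [ab|ba|->] := ltgtP a b; first exact: H.
      by rewrite distrC (distrC (S s a)); exact: H.
    by rewrite !subrr normr0 mulr0.
  have [c _ E] := MVT ab (fun u _ => dS s u)
    (derive_within_continuous (fun u _ => dS s u)).
  rewrite distrC (distrC (S s a)) E normrM mulrA ler_peMl// /kap normfV.
  rewrite ler_pdivlMr ?normr_gt0// mul1r.
  by case/andP: (omb (s + c *: delta)).
have kapd s s' y : `|kap s' y - kap s y| <= L / m ^+ 2 * `|s - s'|.
  have -> : kap s' y - kap s y =
      (om (s + y *: delta) - om (s' + y *: delta)) /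
      (om (s + y *: delta) * om (s' + y *: delta)).
    by rewrite /kap; field; rewrite !om0.
  rewrite normrM normfV normrM [leRHS]mulrAC; apply: ler_pM => //.
    apply: le_trans (omL _ _) _.
    by rewrite opprD addrACA subrr addr0.
  rewrite expr2 lef_pV2 ?posrE ?mulr_gt0 ?normr_gt0//.
  apply: (ler_pM (ltW m0) (ltW m0)); first by case/andP: (omb (s + y *: delta)).
  by case/andP: (omb (s' + y *: delta)).
pose A := W * (L / m ^+ 2 * W).
have A0 : 0 <= A by rewrite /A !mulr_ge0// ?ltW// invr_gt0 exprn_gt0.
(* As [|S_s'| >= 1 / W] for the derivative, the left side is at most [W] times the difference of
   [S s] at the two points. Both [S s (x s t)] and the other function [S s'] at [x s' t] equal [t],
   so this is the difference of two primitives at the one point [x s' t], which has size at most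
   [W |t|]. *)
have xx s s' t : `|x s t - x s' t| <= A * `|t| * `|s - s'|.
  apply: le_trans (SW s _ _) _; rewrite Sx.
  rewrite -[X in X - _](Sx s' t).
  have dD (y : R) : is_derive y (1 : R) (fun y => S s' y - S s y) (kap s' y - kap s y).
    by apply: is_deriveB.
  have := derive_lipschitz dD (kapd s s') (x s' t) 0.
  rewrite !S0 !subr0 => H.
  rewrite /A -!mulrA (ler_wpM2l (ltW W0))//; apply: le_trans H _.
  apply: le_trans (ler_wpM2l _ (xW s' t)) _.
    by rewrite !mulr_ge0// ?invr_ge0 ?exprn_ge0// ltW.
  by rewrite le_eqVlt; apply/orP; left; apply/eqP; ring.
exists (fun t s => s + x s t *: delta); split=> [s|s t|rho rho0].
- by rewrite x0 scale0r addr0.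
- have xd : differentiable (x s) t by apply/derivable1_diffP; case: (dx s t).
  have [dl dlE] := is_diff_scalel (x s t) delta.
  have dd : is_derive t (1 : R) (fun t => x s t *: delta) (om (s + x s t *: delta) *: delta).
    have := is_derive_comp_diff dl (dx s t); rewrite dlE; exact.
  by have := is_deriveD (is_derive_cst s t 1) dd; rewrite add0r.
(* Linear growth is absorbed by [1 + A |t| <= (1 + A / rho) (1 + rho |t|)] and [1 + x <= exp x]. *)
- exists (1 + A / rho); first by rewrite addr_ge0// divr_ge0// ltW.
  move=> t s s'; rewrite opprD addrACA -scalerBl.
  apply: le_trans (ler_normD _ _) _; rewrite normrZ.
  apply: (@le_trans _ _ ((1 + A * `|t|) * `|s - s'|)).
    rewrite mulrDl mul1r lerD2l; apply: le_trans (xx s s' t).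
    by rewrite ler_piMr.
  rewrite ler_wpM2r//; apply: (@le_trans _ _ ((1 + A / rho) * (1 + rho * `|t|))).
    have -> : (1 + A / rho) * (1 + rho * `|t|) =
        1 + A * `|t| + (rho * `|t| + A / rho) by field; rewrite gt_eqF.
    have h1 := mulr_ge0 (ltW rho0) (normr_ge0 t); have h2 := divr_ge0 A0 (ltW rho0).
    by rewrite lerDl addr_ge0.
  rewrite ler_wpM2l ?expR_ge1Dx//.
  by rewrite addr_ge0// divr_ge0// ltW.
Qed.

End ShearFlow.

Lemma is_derive_compR (R : realType) (f g : R -> R) (t a b : R) :
  is_derive (g t) (1 : R) f a -> is_derive t (1 : R) g b ->
  is_derive t (1 : R) (fun t => f (g t)) (a * b).
Proof. exact: is_derive1_comp. Qed.

Section RotatingField.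
Variables (R : realType) (N : nat) (nn : nat -> nat) (e : nat -> R).
Hypotheses (nn0 : (nn 0 <= N)%N) (nn1 : (nn 1 <= N)%N) (nn2 : (nn 2 <= 2 * N)%N).

Let p j := root_poly R (nn j).
Let X j (x : 'rV[R]_3) := (p j).[x 0 (inord j)].
Let D j (x : 'rV[R]_3) := (p j)^`().[x 0 (inord j)].
Let u := @tower R 2 e p 1.
Let G := @tower R 2 e p 2.
Let rho x := X 0 x * X 0 x + X 1 x * X 1 x.

(* With [z = X 2] one has [grad u . F = - 2 rho z D_0 D_1 D_2] and
   [grad G . F = 2 z^2 D_2 G]; on a torus, where [u] and [u^2 + z^2] are then
   governed by the angle of the last circle, only that angle moves. *)
Definition rotating_field (x : 'rV[R]_3) : 'rV[R]_3 :=
  \row_j nth 0 [:: - (X 0 x * X 2 x * D 1 x * D 2 x);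
                   - (X 1 x * X 2 x * D 0 x * D 2 x);
                   2 * rho x * u x * D 0 x * D 1 x + X 2 x * G x] j.

Lemma polyfun_rotating_field j : polyfun (6 * N) (fun x => rotating_field x 0 j).
Proof.
have nnS i : (i < 2)%N -> (nn i.+1 <= 2 ^ i * N)%N by case: i => [|[|]]// _; rewrite mul1n.
have P0 : polyfun N (X 0) by exact: polyfun_root_poly.
have P1 : polyfun N (X 1) by exact: polyfun_root_poly.
have P2 : polyfun (2 * N) (X 2) by exact: polyfun_root_poly.
have Q0 : polyfun N (D 0) by apply: polyfun_root_poly_deriv; exact: leqW.
have Q1 : polyfun N (D 1) by apply: polyfun_root_poly_deriv; exact: leqW.
have Q2 : polyfun (2 * N) (D 2) by apply: polyfun_root_poly_deriv; exact: leqW.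
have Pu : polyfun (2 * N) u by exact: (polyfun_tower (i := 1) e nn0 nnS isT).
have PG : polyfun (4 * N) G by exact: (polyfun_tower (i := 2) e nn0 nnS isT).
have Pr : polyfun (N + N) rho by apply: polyfun_add; apply: polyfun_mul.
have neg (f : 'rV[R]_3 -> R) k : polyfun k f -> polyfun k (fun x => - f x).
  move=> fk; under eq_fun do rewrite -mulN1r; rewrite -[k]add0n.
  by apply: polyfun_mul => //; exact: polyfun_cst.
under eq_fun do rewrite mxE.
case: j => -[|[|[|//]]] j3 /=.
- apply: neg; apply: (polyfunW (k := N + 2 * N + N + 2 * N)); first by lia.
  by do 3 apply: polyfun_mul => //.
- apply: neg; apply: (polyfunW (k := N + 2 * N + N + 2 * N)); first by lia.
  by do 3 apply: polyfun_mul => //.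
- apply: polyfun_add.
    apply: (polyfunW (k := 0 + (N + N) + 2 * N + N + N)); first by lia.
    by do 4 apply: polyfun_mul => //; exact: polyfun_cst.
  by apply: (polyfunW (k := 2 * N + 4 * N)); [lia|exact: polyfun_mul].
Qed.

Lemma rotating_field0 x : rotating_field x 0 (inord 0) = - (X 0 x * X 2 x * D 1 x * D 2 x).
Proof. by rewrite mxE inordK. Qed.

Lemma rotating_field1 x : rotating_field x 0 (inord 1) = - (X 1 x * X 2 x * D 0 x * D 2 x).
Proof. by rewrite mxE inordK. Qed.

Lemma rotating_field2 x : rotating_field x 0 (inord 2) =
  2 * rho x * u x * D 0 x * D 1 x + X 2 x * G x.
Proof. by rewrite mxE inordK. Qed.

Lemma dot_tower_grad1 x : dot (@tower_grad R 2 e p 1 x) (rotating_field x) =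
  - 2 * rho x * X 2 x * D 0 x * D 1 x * D 2 x.
Proof.
rewrite /= dotDl !dotZl !(dotC (delta_mx _ _)) !dot_delta rotating_field0 rotating_field1.
rewrite /rho /X /D; ring.
Qed.

(** The rotational terms cancel; what is left comes from the summand [X 2 x * G x], which vanishes
    on the torus and supplies the normal rate. *)
Lemma dot_tower_grad2 x : dot (@tower_grad R 2 e p 2 x) (rotating_field x) =
  2 * X 2 x * X 2 x * D 2 x * G x.
Proof.
have -> : dot (@tower_grad R 2 e p 2 x) (rotating_field x) =
    2 * u x * dot (@tower_grad R 2 e p 1 x) (rotating_field x) +
    2 * (X 2 x * D 2 x) * rotating_field x 0 (inord 2).
  by rewrite [X in dot X _]/= dotDl !dotZl (dotC (delta_mx _ _)) dot_delta.
rewrite dot_tower_grad1 rotating_field2; ring.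
Qed.

Variables (a : R) (psi : nat -> R -> R) (w : nat -> R).
Hypothesis e_gt0 : forall i, 0 < e i.
Hypothesis e_decr : forall i, 2 * e i.+1 < e i ^+ 2.
Hypothesis e_small : forall i, 2 * e i < a ^+ 2.
Hypothesis a_gt0 : 0 < a.
Hypothesis psi_inverse : forall j, (j <= 2)%N -> forall y, `|y| < a ->
  [/\ (p j).[psi j y] = y, 0 < (p j)^`().[psi j y] * w j &
      is_derive y (1 : R) (psi j) ((p j)^`().[psi j y])^-1].

Let psi_inverse' : forall j, (j <= 2)%N -> forall y, `|y| < a ->
  [/\ (p j).[psi j y] = y, (p j)^`().[psi j y] != 0 &
      is_derive y (1 : R) (psi j) ((p j)^`().[psi j y])^-1].
Proof.
move=> j j2 y ya; have [? p0 ?] := psi_inverse j2 ya; split=> //.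
by apply/eqP => p'0; move: p0; rewrite p'0 mul0r ltxx.
Qed.

Let h := @torus_map R 2 e psi.

Let hh : torus_embedding h.
Proof. exact (@torus_map_embedding R 2 e e_gt0 e_decr a p psi e_small a_gt0 psi_inverse'). Qed.

Let Gh s : G (h s) = 0.
Proof.
by rewrite /G (tower_torus_map e_gt0 e_decr e_small a_gt0 psi_inverse')// level_top.
Qed.

Let uh s : u (h s) = level e 1 s.
Proof. by rewrite /u (tower_torus_map e_gt0 e_decr e_small a_gt0 psi_inverse'). Qed.

Let Xh j s : (j <= 2)%N -> X j (h s) = tube_coord e j s.
Proof.
by move=> j2; rewrite /X (torus_map_coord e_gt0 e_decr e_small a_gt0 psi_inverse').
Qed.

Let Dw j s : (j <= 2)%N -> 0 < D j (h s) * w j.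
Proof.
move=> j2; rewrite /D /h mxE inordK//.
have yb := tube_coord_lt e_gt0 e_decr e_small a_gt0 s j2.
by have [] := psi_inverse j2 yb.
Qed.

Let Dn0 j s : (j <= 2)%N -> D j (h s) != 0.
Proof.
by move=> j2; apply/eqP => D0; have := Dw s j2; rewrite D0 mul0r ltxx.
Qed.

Let rhoh s : rho (h s) = radius e 0 s ^+ 2.
Proof.
rewrite radius_sqr// -uh /u [tower e p 1 _]/= /rho /X; ring.
Qed.

Let radius1 (s : 'rV[R]_2) : radius e 1 s = Num.sqrt (e 1%N).
Proof. by rewrite /radius (level_top e s) addr0. Qed.

(** The speed of the last angle in turns: with [z = sqrt (e_1) sin (2 pi theta)] and
    [u = sqrt (e_1) cos (2 pi theta)] one has [z' = 2 pi theta' u], which has to be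
    [2 rho u D_0 D_1 D_2]. *)
Let Om x := rho x * (D 0 x * D 1 x * D 2 x) / pi.

(** The first angle is fixed, so [y_0] and [y_1] move only through [r_0]:
    [y_0' = y_0 u' / (2 r_0^2)], and likewise for [y_1]. Since [rho = r_0^2] on the torus, the
    factor [rho] in the speed cancels the denominator; this is what keeps the field polynomial. *)
Lemma torus_rotation (c : R -> 'rV[R]_2) (t : R) :
  is_derive t (1 : R) c (Om (h (c t)) *: angle_grad R 2 1) ->
  is_derive t (1 : R) (fun t => h (c t)) (rotating_field (h (c t))).
Proof.
move=> dc; set om := Om _ in dc.
have ag i j : (i < 2)%N -> (j < 2)%N ->
    dot (angle_grad R 2 i) (angle_grad R 2 j) = (i == j)%:R.
  move=> i2 j2; rewrite /angle_grad (insubT (fun k => (k < 2)%N) i2).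
  by rewrite (insubT (fun k => (k < 2)%N) j2) /= dot_delta mxE /= -val_eqE /= eq_sym.
have da0 : is_derive t (1 : R) (fun t => angle 0 (c t)) 0.
  by have := C1_along (C1_angle R 2 0) dc; rewrite dotZr ag// mulr0.
have da1 : is_derive t (1 : R) (fun t => angle 1 (c t)) om.
  by have := C1_along (C1_angle R 2 1) dc; rewrite dotZr ag// mulr1.
have pi0 : (pi : R) != 0 by rewrite gt_eqF// pi_gt0.
have r0 : radius e 0 (c t) != 0 by rewrite gt_eqF// (radius_gt0 e_gt0 e_decr).
have dcos i b : is_derive t (1 : R) (fun t => angle i (c t)) b ->
    is_derive t (1 : R) (fun t => cos (2 * pi * angle i (c t)))
      (- (2 * pi * b * sin (2 * pi * angle i (c t)))).
  move=> db; have dl : is_derive (angle i (c t)) (1 : R) (fun y => cos (2 * pi * y))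
      (- (2 * pi * sin (2 * pi * angle i (c t)))).
    by apply: is_derive_eq; rewrite /GRing.scale /=; ring.
  have := is_derive_compR dl db; move/is_derive_eq; apply; ring.
have dsin i b : is_derive t (1 : R) (fun t => angle i (c t)) b ->
    is_derive t (1 : R) (fun t => sin (2 * pi * angle i (c t)))
      (2 * pi * b * cos (2 * pi * angle i (c t))).
  move=> db; have dl : is_derive (angle i (c t)) (1 : R) (fun y => sin (2 * pi * y))
      (2 * pi * cos (2 * pi * angle i (c t))).
    by apply: is_derive_eq; rewrite /GRing.scale /=; ring.
  have := is_derive_compR dl db; move/is_derive_eq; apply; ring.
have dL : is_derive t (1 : R) (fun t => level e 1 (c t))
    (- (2 * pi * om * X 2 (h (c t)))).
  rewrite (_ : (fun t => _) = fun t => Num.sqrt (e 1%N) * cos (2 * pi * angle 1 (c t))).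
    have := is_deriveM (is_derive_cst (Num.sqrt (e 1%N)) t 1) (dcos _ _ da1).
    move/is_derive_eq; apply; rewrite Xh//= radius1 /GRing.scale /=; ring.
  by apply/funext => v; rewrite levelE// radius1.
have dr : is_derive t (1 : R) (fun t => radius e 0 (c t))
    ((2 * radius e 0 (c t))^-1 * - (2 * pi * om * X 2 (h (c t)))).
  have dl : is_derive t (1 : R) (fun t => e 0%N + level e 1 (c t))
      (- (2 * pi * om * X 2 (h (c t)))).
    by have := is_deriveD (is_derive_cst (e 0%N) t 1) dL; rewrite add0r.
  apply: (is_derive_compR (f := Num.sqrt)) dl.
  apply: is_derive1_sqrt; exact: (radius_sqr_gt0 e_gt0 e_decr).
have dpsi j b : (j <= 2)%N -> is_derive t (1 : R) (fun t => tube_coord e j (c t)) b ->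
    is_derive t (1 : R) (fun t => h (c t) 0 (inord j)) ((D j (h (c t)))^-1 * b).
  move=> j2 db; rewrite (_ : (fun t => _) = fun t => psi j (tube_coord e j (c t))).
    rewrite /D /h mxE inordK//; apply: is_derive_compR db.
    have yb := tube_coord_lt e_gt0 e_decr e_small a_gt0 (c t) j2.
    by have [] := psi_inverse j2 yb.
  by apply/funext => v; rewrite mxE inordK.
have omE : om = radius e 0 (c t) ^+ 2 * (D 0 (h (c t)) * D 1 (h (c t)) * D 2 (h (c t))) / pi.
  by rewrite /om /Om rhoh.
have d0 := Dn0 (c t) (leq0n 2); have d1 := Dn0 (c t) (isT : (1 <= 2)%N).
have d2 := Dn0 (c t) (leqnn 2).
have X2h := Xh (c t) (leqnn 2); have X1h := Xh (c t) (isT : (1 <= 2)%N).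
have X0h := Xh (c t) (leq0n 2).
have tub0 : is_derive t (1 : R) (fun t => tube_coord e 0 (c t))
    (cos (2 * pi * angle 0 (c t)) *
      ((2 * radius e 0 (c t))^-1 * - (2 * pi * om * X 2 (h (c t))))).
  rewrite (_ : (fun t => _) = fun t => radius e 0 (c t) * cos (2 * pi * angle 0 (c t))).
    have := is_deriveM dr (dcos _ _ da0); move/is_derive_eq; apply.
    by rewrite /GRing.scale /=; ring.
  by apply/funext => v; rewrite /= levelE.
have tub1 : is_derive t (1 : R) (fun t => tube_coord e 1 (c t))
    (sin (2 * pi * angle 0 (c t)) *
      ((2 * radius e 0 (c t))^-1 * - (2 * pi * om * X 2 (h (c t))))).
  have := is_deriveM dr (dsin _ _ da0); move/is_derive_eq; apply.
  by rewrite /GRing.scale /=; ring.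
have tub2 : is_derive t (1 : R) (fun t => tube_coord e 2 (c t))
    (2 * pi * om * u (h (c t))).
  rewrite (_ : (fun t => _) = fun t => Num.sqrt (e 1%N) * sin (2 * pi * angle 1 (c t))).
    have := is_deriveM (is_derive_cst (Num.sqrt (e 1%N)) t 1) (dsin _ _ da1).
    move/is_derive_eq; apply; rewrite uh levelE// radius1 /GRing.scale /=; ring.
  by apply/funext => v; rewrite /= radius1.
have ordE (j : 'I_3) : j = inord j by rewrite inord_val.
apply: is_derive_row => j; rewrite (ordE j).
case: j => -[|[|[|//]]] j3 /=.
- have := dpsi 0%N _ isT tub0; move/is_derive_eq; apply.
  rewrite rotating_field0 omE X0h /= levelE//.
  move: (pi : R) pi0 => P P0; field.
  by rewrite P0 r0 d0.
- have := dpsi 1%N _ isT tub1; move/is_derive_eq; apply.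
  rewrite rotating_field1 omE X1h /=.
  move: (pi : R) pi0 => P P0; field.
  by rewrite P0 r0 d1.
- have := dpsi 2%N _ isT tub2; move/is_derive_eq; apply.
  rewrite rotating_field2 omE Gh rhoh.
  move: (pi : R) pi0 => P P0; field.
  by rewrite P0 d2.
Qed.

(** On the torus the normal rate has the sign of [D_2], which alternates with the chosen root, so
    the torus attracts either for the field or for the reversed one. *)
Theorem rotating_torus (r : nat) :
  normally_hyperbolic_torus 2 r rotating_field (range h).
Proof.
have hc := embedding_continuous hh; have hper := embedding_periodic hh.
have FL : locally_lipschitz rotating_field.
  apply: locally_lipschitz_row => j; apply: polyfun_locally_lipschitz.
  exact: polyfun_rotating_field.
have XL j : locally_lipschitz (X j).
  by apply: polyfun_locally_lipschitz; exact: polyfun_root_poly (leqnn (nn j)).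
have DL j : locally_lipschitz (D j).
  by apply: polyfun_locally_lipschitz; exact: polyfun_root_poly_deriv (leqW (leqnn (nn j))).
have cL (k : R) : locally_lipschitz (fun _ : 'rV[R]_3 => k) by exact: locally_lipschitz_cst.
have tL : forall i, locally_lipschitz (@tower R 2 e p i).
  elim=> [|i IH]; first exact: XL.
  apply: locally_lipschitz_add; last exact: cL.
  by apply: locally_lipschitz_add; apply: locally_lipschitz_mul => //; exact: (XL i.+1).
have rL : locally_lipschitz rho by apply: locally_lipschitz_add; apply: locally_lipschitz_mul.
have DDL : locally_lipschitz (fun x => D 0 x * D 1 x * D 2 x).
  by apply: locally_lipschitz_mul => //; apply: locally_lipschitz_mul.
have OmL : locally_lipschitz Om.
  by apply: locally_lipschitz_mul => //; apply: locally_lipschitz_mul.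
have comp_c (f : 'rV[R]_3 -> R) : continuous f -> continuous (fun s => f (h s)).
  by move=> fc s; apply: (@continuous_comp _ _ _ h f); [exact: hc|exact: fc].
have hmax (f : 'rV[R]_3 -> R) : locally_lipschitz f ->
    exists s0, forall s, f (h s) <= f (h s0).
  move=> fL; have fc := comp_c f (locally_lipschitz_continuous fL).
  have [s0 s0m] := periodic_max fc (fun x k => congr1 f (hper x k)).
  by exists s0.
have normL (f : 'rV[R]_3 -> R) : locally_lipschitz f -> locally_lipschitz (fun x => `|f x|).
  move=> fL B; have [L L0 fB] := fL B; exists L => // x y xB yB.
  exact: le_trans (ler_dist_dist _ _) (fB x y xB yB).
have negL (f : 'rV[R]_3 -> R) : locally_lipschitz f -> locally_lipschitz (fun x => - f x).
  move=> fL B; have [L L0 fB] := fL B; exists L => // x y xB yB.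
  by rewrite -opprD normrN; exact: fB.
have rho0 s : 0 < rho (h s).
  by rewrite rhoh exprn_gt0// (radius_gt0 e_gt0 e_decr).
have pi0 : 0 < (pi : R) by exact: pi_gt0.
have Om0 s : Om (h s) != 0.
  by rewrite /Om mulf_neq0 ?invr_eq0 ?(gt_eqF pi0)// mulf_neq0 ?(gt_eqF (rho0 s))//
    !mulf_neq0 ?Dn0.
have [sW sWm] := hmax _ (normL _ OmL).
have [sm smm] := hmax _ (negL _ (normL _ OmL)).
have nhc : continuous (fun s => `|h s|) by move=> s; have /cvg_norm := hc s; apply.
have [sB sBm] := periodic_max nhc (fun x k => congr1 Num.norm (hper x k)).
have [Ch Ch0 hCh] := embedding_lipschitz hh.
have [LO LO0 OmLip] := OmL `|h sB|.
have omL x y : `|Om (h x) - Om (h y)| <= (LO * Ch + 1) * `|x - y|.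
  apply: le_trans (OmLip _ _ (sBm x) (sBm y)) _.
  apply: le_trans (ler_wpM2l (ltW LO0) (hCh x y)) _.
  by rewrite mulrA ler_wpM2r// lerDl.
have LC0 : 0 < LO * Ch + 1 by rewrite ltr_wpDl// mulr_ge0// ltW.
have m0 : 0 < `|Om (h sm)| by rewrite normr_gt0.
have omb x : `|Om (h sm)| <= `|Om (h x)| <= `|Om (h sW)|.
  by rewrite sWm andbT -lerN2 smm.
have d1 : `|angle_grad R 2 1| <= 1.
  rewrite /angle_grad (insubT (fun k => (k < 2)%N) (isT : (1 < 2)%N)) /=.
  apply: norm_le_coord => // i; rewrite mxE.
  by case: (_ && _); rewrite ?normr1 ?normr0.
have [Psi [Psi0 dPsi PsiL]] := shear_flow LC0 m0 d1 omL omb.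
have hPsi s (t : R) :
    is_derive t (1 : R) (fun t => h (Psi t s)) (rotating_field (h (Psi t s))).
  exact: torus_rotation (dPsi s t).
pose q x := rho x * `|D 0 x * D 1 x|.
have qL : locally_lipschitz q.
  by apply: locally_lipschitz_mul => //; apply: normL; apply: locally_lipschitz_mul.
have [sQ sQm] := hmax q qL.
have q0 s : 0 < q (h s) by rewrite /q mulr_gt0// normr_gt0 mulf_neq0// Dn0.
(* The sign makes [lam rho D_0 D_1] positive on the torus, and the denominator, built from the
   maximum of [q = rho |D_0 D_1|], keeps it below [1]. *)
pose lam := Num.sg (w 0%N * w 1%N) / (2 * (q (h sQ) + 1)).
have lamE s : lam * rho (h s) * (D 0 (h s) * D 1 (h s)) = q (h s) / (2 * (q (h sQ) + 1)).
  have D01 : 0 < (D 0 (h s) * D 1 (h s)) * (w 0%N * w 1%N).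
    by rewrite mulrACA mulr_gt0// Dw.
  have sgE : `|D 0 (h s) * D 1 (h s)| =
      Num.sg (w 0%N * w 1%N) * (D 0 (h s) * D 1 (h s)).
    have [w0|w0|/esym w0] := ltgtP 0 (w 0%N * w 1%N).
    - by rewrite gtr0_sg// mul1r gtr0_norm//; move: D01; rewrite pmulr_lgt0.
    - by rewrite ltr0_sg// mulN1r ltr0_norm//; move: D01; rewrite nmulr_lgt0.
    - by move: D01; rewrite w0 mulr0 ltxx.
  by rewrite [in RHS]/q sgE /lam; ring.
have lam01 s : 0 < lam * rho (h s) * (D 0 (h s) * D 1 (h s)) < 1.
  have := q0 s; have := sQm s; have := q0 sQ; rewrite lamE => ? ? ?.
  by rewrite divr_gt0 ?ltr_pdivrMr; lra.
(* The rate [2 z^2 D_2] of [G] vanishes at [z = 0]; that of [Gt] is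
   [D_2 (z^2 (2 - 2 b) + 2 b u^2)] with [0 < b < 1] on the torus. *)
pose Gt x := G x * expR (lam * (u x * X 2 x)).
pose K x := 2 * X 2 x * X 2 x * D 2 x +
  lam * (u x * (D 2 x * (2 * rho x * u x * D 0 x * D 1 x + X 2 x * G x)) +
         X 2 x * (- 2 * rho x * X 2 x * D 0 x * D 1 x * D 2 x)).
have uC := @C1_tower R 2 e p 1; have GC := @C1_tower R 2 e p 2.
have XC := C1_horner_coord (p 2) (inord 2 : 'I_3).
have GtC := C1_mul GC (C1_exp (C1_mul (C1_cst _ lam) (C1_mul uC XC))).
set g := (fun x => _ + _) in GtC.
have gF x : dot (g x) (rotating_field x) = K x * Gt x.
  have := dot_tower_grad1 x; have := dot_tower_grad2 x; rewrite /g.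
  move: (@tower_grad R 2 e p 1 x) (@tower_grad R 2 e p 2 x) => T1 T2 E2 E1.
  rewrite !(dotDl, dotZl) dot0l E1 E2 (dotC (delta_mx _ _)) dot_delta rotating_field2.
  rewrite -/u -/G /K /Gt -[(p 2).[_]]/(X 2 x) -[(p 2)^`().[_]]/(D 2 x).
  by rewrite /cst; ring.
have KL : locally_lipschitz K.
  repeat (first [exact: cL | exact: XL | exact: DL | exact: (tL 1%N) | exact: (tL 2%N) |
    exact: rL | apply: locally_lipschitz_add | apply: locally_lipschitz_mul]).
have Ksign s : 0 < K (h s) * w 2.
  have ww := lam01 s; have U2 := Gh s.
  set b := lam * _ * _ in ww; set z := X 2 (h s); set v := u (h s).
  (* This is [G = 0]; it forbids [u] and [z] to vanish together, so the sum of squares below is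
     positive. *)
  have uz : v * v + z * z = e 1%N.
    have U3 : v * v + z * z - e 1%N = 0 by exact: U2.
    lra.
  have -> : K (h s) * w 2 = (2 * (1 - b) * z ^+ 2 + 2 * b * v ^+ 2) * (D 2 (h s) * w 2).
    by rewrite /K -/v -/z Gh /b; ring.
  rewrite mulr_gt0 ?Dw//; case/andP: ww => b0 b1.
  have [v0|v0] := eqVneq v 0.
    rewrite v0 expr0n /= mulr0 addr0 mulr_gt0//; first by lra.
    by move: uz; rewrite v0 mulr0 add0r -expr2 => ->.
  have v2 : 0 < v ^+ 2 by rewrite lt_neqAle sqr_ge0 andbT eq_sym expf_eq0 /= v0.
  have z2 : 0 <= z ^+ 2 by exact: sqr_ge0.
  rewrite ltr_wpDl//; first by rewrite mulr_ge0//; lra.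
  by rewrite mulr_gt0//; lra.
have gn0 s : g (h s) != 0.
  have -> : g (h s) = expR (lam * (u (h s) * X 2 (h s))) *: @tower_grad R 2 e p 2 (h s).
    by rewrite /g -/(G (h s)) Gh scale0r add0r.
  rewrite scaler_eq0 negb_or (gt_eqF (expR_gt0 _)) andTb.
  have [j _] := tower_grad_neq0 e_gt0 e_decr e_small a_gt0 psi_inverse' s (leqnn 2).
  by apply: contra_neq => gE; have := congr1 (fun v : 'rV[R]_3 => v 0 j) gE;
    rewrite [X in _ = X]mxE.
have {}GtC : C1 Gt g by exact: GtC.
have Gth s : Gt (h s) = 0 by rewrite /Gt Gh mul0r.
exists h; split=> //.
  move=> t _ [s _ <-]; exists (h (Psi t s)); last by exists (Psi t s).
  by exists (fun t => h (Psi t s)); split=> //; rewrite Psi0.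
have [w0|w0|/esym w0] := ltgtP 0 (w 2); last by have := Ksign 0; rewrite w0 mulr0 ltxx.
- right; have Npsi0 s : Psi (- 0) s = s by rewrite oppr0.
  have NhPsi s (t : R) : is_derive t (1 : R) (fun t => h (Psi (- t) s))
      (- rotating_field (h (Psi (- t) s))).
    exact: (is_derive_opp_arg (c := fun t => h (Psi t s))).
  have NPsiL rh : 0 < rh -> exists2 C : R, 0 <= C & forall t s s',
      `|Psi (- t) s - Psi (- t) s'| <= C * expR (rh * `|t|) * `|s - s'|.
    move=> rh0; have [C C0 hC] := PsiL rh rh0; exists C => // t s s'.
    by rewrite -(normrN t); exact: hC.
  have NgF x : dot (g x) (- rotating_field x) = - K x * Gt x by rewrite dotNr gF mulNr.
  have NK s : - K (h s) < 0 by have := Ksign s; rewrite oppr_lt0 pmulr_lgt0.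
  exact: (@normal_hyperbolicity_criterion R 2 r _ h (fun t s => Psi (- t) s) Gt
    (fun x => - K x) g (locally_lipschitzN FL) hh Npsi0 NhPsi NPsiL GtC NgF (negL _ KL)
    (fun s => And3 (Gth s) (gn0 s) (NK s))).
- left; have NK s : K (h s) < 0 by have := Ksign s; rewrite nmulr_lgt0.
  exact: (@normal_hyperbolicity_criterion R 2 r _ h Psi Gt K g FL hh Psi0 hPsi PsiL GtC
    gF KL (fun s => And3 (Gth s) (gn0 s) (NK s))).
Qed.

End RotatingField.

(** * Counting tori *)

Section Counting.
Variable R : realType.

Lemma finite_pos_lower_bound (f : nat -> R) n : (forall i, 0 < f i) ->
  exists2 a : R, 0 < a & forall i, (i < n)%N -> a <= f i.
Proof.
move=> f0; elim: n => [|n [a a0 IH]]; first by exists 1.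
exists (Num.min a (f n)); first by rewrite lt_min a0 f0.
move=> i; rewrite ltnS leq_eqVlt => /predU1P[->|/IH ai]; first by rewrite ge_min lexx orbT.
by rewrite ge_min ai.
Qed.

(** Only finitely many pairs of a factor and a root occur, so a single [a] serves all local
    inverses. This is what allows one choice of [e] for all tori. *)
Lemma root_poly_inverses (nn : nat -> nat) d :
  exists2 a : R, 0 < a & exists psi : nat -> nat -> R -> R,
    forall j k, (j <= d)%N -> (k < nn j)%N -> forall y, `|y| < a ->
    [/\ (root_poly R (nn j)).[psi j k y] = y, `|psi j k y - k%:R| < 2^-1,
        0 < (root_poly R (nn j))^`().[psi j k y] * (root_poly R (nn j))^`().[k%:R] &
        is_derive y (1 : R) (psi j k) ((root_poly R (nn j))^`().[psi j k y])^-1].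
Proof.
have H j k : exists ap : R * (R -> R), 0 < ap.1 /\ ((k < nn j)%N ->
    forall y, `|y| < ap.1 ->
    [/\ (root_poly R (nn j)).[ap.2 y] = y, `|ap.2 y - k%:R| < 2^-1,
        0 < (root_poly R (nn j))^`().[ap.2 y] * (root_poly R (nn j))^`().[k%:R] &
        is_derive y (1 : R) ap.2 ((root_poly R (nn j))^`().[ap.2 y])^-1]).
  have [kn|kn] := boolP (k < nn j)%N; last by exists (1, id); split.
  have h2 : (0 : R) < 2^-1 by rewrite invr_gt0.
  have [a a0 [psi psiP]] := poly_local_inverse h2 (root_poly_root R kn)
    (root_poly_deriv_neq0 R kn).
  by exists (a, psi).
pose A j k := (projT1 (cid (H j k))).1.
have A0 j k : 0 < A j k by rewrite /A; case: (cid _) => ? [].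
have A1 j : exists b : R, 0 < b /\ forall k, (k < nn j)%N -> b <= A j k.
  by have [b b0 bA] := finite_pos_lower_bound (nn j) (A0 j); exists b.
pose B j := projT1 (cid (A1 j)).
have B0 j : 0 < B j by rewrite /B; case: (cid _) => ? [].
have [a a0 aB] := finite_pos_lower_bound d.+1 B0.
exists a => //; exists (fun j k => (projT1 (cid (H j k))).2) => j k jd kn y ya.
have : `|y| < A j k.
  apply: lt_le_trans ya (le_trans (aB j jd) _).
  by rewrite /B; case: (cid _) => b [_ /= bA]; exact: bA.
by rewrite /A; case: (cid _) => -[b f] [_ /= bf]; exact: bf.
Qed.

(** Repeated cubing: [e_(i+1) = e_i^3] and [e_i <= 1/4] give [2 e_(i+1) < e_i^2], while
    [e_i <= a^2 / 4] gives the last bound. *)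
Lemma tower_scales (a : R) : 0 < a -> exists e : nat -> R, [/\ forall i, 0 < e i,
  forall i, 2 * e i.+1 < e i ^+ 2 & forall i, 2 * e i < a ^+ 2].
Proof.
move=> a0; have a20 : 0 < a ^+ 2 by rewrite exprn_gt0.
pose E := Num.min 4^-1 (a ^+ 2 / 4); pose e i := iter i (fun x => x ^+ 3) E.
have E0 : 0 < E by rewrite lt_min invr_gt0 divr_gt0//= ltr0n.
have E4 : E <= 4^-1 by rewrite ge_min lexx.
have Ea : E <= a ^+ 2 / 4 by rewrite ge_min lexx orbT.
have e0 i : 0 < e i by elim: i => [|i IH] //=; rewrite exprn_gt0.
have eE i : e i <= E.
  elim: i => [|i IH] //=; apply: le_trans (IH); rewrite -[leRHS]mulr1 exprS.
  rewrite (ler_wpM2l (ltW (e0 i)))// expr_le1// ?(ltW (e0 i))//.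
  by have := le_trans IH E4; lra.
exists e; split=> // i; last by have := eE i; lra.
rewrite /= exprS mulrA -ltr_pdivlMr ?exprn_gt0// divff ?gt_eqF ?exprn_gt0//.
by have := eE i; lra.
Qed.

Lemma counting_ge (T : choiceType) (A : set T) (I : finType) (f : I -> T) :
  injective f -> (forall i, A (f i)) -> ((#|I|%:R : R)%:E <= counting A)%E.
Proof.
move=> fi fA; rewrite /counting; case: asboolP => [Af|_]; last exact: leey.
rewrite lee_fin ler_nat cardE -(size_map f); apply: uniq_leq_size.
  by rewrite map_inj_uniq// enum_uniq.
by move=> _ /mapP[i _ ->]; rewrite in_fset_set// inE.
Qed.

Definition tower_degrees (d N c j : nat) := if (j < d)%N then N else (c * N)%N.

(** In the hypothesis the field is fixed before the local inverses [psi], so a single field carries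
    one torus for each choice of a root in every coordinate. The numbers [w j] stand for the
    derivatives at the chosen roots. *)
Lemma max_num_tori_ge (r d N c k m : nat) : (k <= m)%N ->
  (forall (a : R) (e : nat -> R), 0 < a -> (forall i, 0 < e i) ->
    (forall i, 2 * e i.+1 < e i ^+ 2) -> (forall i, 2 * e i < a ^+ 2) ->
    exists2 F : 'rV[R]_d.+1 -> 'rV[R]_d.+1, forall j, polyfun k (fun x => F x 0 j) &
    forall (psi : nat -> R -> R) (w : nat -> R),
      (forall j, (j <= d)%N -> forall y, `|y| < a ->
        [/\ (root_poly R (tower_degrees d N c j)).[psi j y] = y,
            0 < (root_poly R (tower_degrees d N c j))^`().[psi j y] * w j &
            is_derive y (1 : R) (psi j)
              ((root_poly R (tower_degrees d N c j))^`().[psi j y])^-1]) ->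
      normally_hyperbolic_torus d r F (range (@torus_map R d e psi))) ->
  (((c * N ^ d.+1)%:R : R)%:E <= max_num_tori R r d m)%E.
Proof.
move=> km H; have [a a0 [psi psiP]] := root_poly_inverses (tower_degrees d N c) d.
have [e [e0 eS ea]] := tower_scales a0.
have [F Fk FT] := H a e a0 e0 eS ea.
have [P Pk PF] := polyfun_field Fk.
apply: (@le_trans _ _ (num_tori r P)); last first.
  apply: ereal_sup_ubound; exists P => //=; exact: leq_trans Pk km.
(* A choice of roots: one of [N] in each of the first [d] coordinates, one of [c N] in the last. *)
pose I := ({ffun 'I_d -> 'I_N} * 'I_(c * N))%type.
pose kap (i : I) j : nat := oapp (fun l => nat_of_ord (i.1 l)) i.2 (insub j).
have kap_lt i j : (kap i j < tower_degrees d N c j)%N.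
  by rewrite /kap /tower_degrees; case: insubP => [l -> _|/negbTE ->] /=.
have cardI : #|{: I}| = (c * N ^ d.+1)%N.
  by rewrite card_prod card_ffun !card_ord mulnCA expnSr.
pose M (i : I) := range (@torus_map R d e (fun j => psi j (kap i j))).
have psi1 i j : (j <= d)%N -> forall y, `|y| < a ->
    [/\ (root_poly R (tower_degrees d N c j)).[psi j (kap i j) y] = y,
      0 < (root_poly R (tower_degrees d N c j))^`().[psi j (kap i j) y] *
          (root_poly R (tower_degrees d N c j))^`().[(kap i j)%:R] &
      is_derive y (1 : R) (psi j (kap i j))
        ((root_poly R (tower_degrees d N c j))^`().[psi j (kap i j) y])^-1].
  by move=> jd y ya; have [] := psiP j (kap i j) jd (kap_lt i j) y ya.
have near i x j : (j <= d)%N -> M i x -> `|x 0 (inord j) - (kap i j)%:R| < 2^-1.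
  move=> jd [s _ <-]; rewrite mxE inordK//.
  have ya := tube_coord_lt e0 eS ea a0 s jd.
  by have [] := psiP j (kap i j) jd (kap_lt i j) _ ya.
(* Each coordinate of a common point is within [1/2] of both integers, so they differ by less than
   [1]. *)
have kap_eq i i' j : M i = M i' -> (j <= d)%N -> kap i j = kap i' j.
  move=> MM jd; pose x := @torus_map R d e (fun j => psi j (kap i j)) 0.
  have Mx : M i x by exists 0.
  have h1 := near i x j jd Mx; have h2 : `|x 0 (inord j) - (kap i' j)%:R| < 2^-1.
    by apply: near => //; rewrite -MM.
  have : `|(kap i j)%:R - (kap i' j)%:R : R| < 1.
    have := ler_normB (x 0 (inord j) - (kap i' j)%:R) (x 0 (inord j) - (kap i j)%:R).
    rewrite opprB addrC subrKA => h3; apply: le_lt_trans h3 _.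
    have : (2^-1 : R) + 2^-1 = 1 by field.
    lra.
  case: (ltngtP (kap i j) (kap i' j)) => // kk.
    rewrite distrC -natrB ?(ltnW kk)// normr_nat ltrn1; lia.
  rewrite -natrB ?(ltnW kk)// normr_nat ltrn1; lia.
have Minj : injective M.
  move=> [f l] [f' l'] MM; have kk j jd := kap_eq _ _ j MM jd.
  congr (_, _).
    apply/ffunP => i; apply/val_inj; have := kk i (ltnW (ltn_ord i)).
    by rewrite /kap valK.
  apply/val_inj; have := kk d (leqnn d).
  by rewrite /kap insubF// ltnn.
rewrite -cardI /num_tori PF; apply: counting_ge Minj _ => i.
exact: FT (psi1 i).
Qed.

Lemma limn_einf_le (u v : nat -> \bar R) : (\forall n \near \oo, (u n <= v n)%E) ->
  (limn_einf u <= limn_einf v)%E.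
Proof.
move=> [N _ uv]; rewrite !limn_einf_lim.
apply: lee_lim; [exact: is_cvg_einfs|exact: is_cvg_einfs|].
exists N => // n /= Nn; apply: le_ereal_inf_tmp => _ [k /= nk <-].
apply: le_trans (uv k _); last exact: leq_trans Nn nk.
by apply: ereal_inf_lbound; exists k.
Qed.

(** Taking [N] as the integer part of [m / k] loses at most [1 / m] in [N / m], which disappears in
    the limit. *)
Lemma limn_einf_power_growth (u : nat -> \bar R) (d c k : nat) : (0 < k)%N ->
  (forall N m, (k * N <= m)%N -> (((c * N ^ d)%:R : R)%:E <= u m)%E) ->
  ((c%:R / k%:R ^+ d)%:E <= limn_einf (fun m => u m * ((m%:R ^+ d)^-1)%:E))%E.
Proof.
(* [harmonic m] is [1 / (m + 1)]; twice it dominates [1 / m] for [m >= 1]. *)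
move=> k0 uN; pose v m : R := c%:R * (k%:R^-1 - 2 * harmonic m) ^+ d.
have vL : v @ \oo --> (c%:R / k%:R ^+ d : R).
  rewrite -exprVn; apply: cvgM; first exact: cvg_cst.
  have h : (fun m => k%:R^-1 - 2 * harmonic m : R) @ \oo --> (k%:R^-1 : R).
    rewrite -[X in _ --> X]subr0 -(mulr0 2); apply: cvgB; first exact: cvg_cst.
    by apply: cvgM; [exact: cvg_cst|exact: cvg_harmonic].
  by apply: (cvg_comp _ (fun x : R => x ^+ d) h); exact: exprn_continuous.
have vE : (EFin \o v) @ \oo --> ((c%:R / k%:R ^+ d : R)%:E) by apply: cvg_EFin => //; exact: nearW.
rewrite -(cvg_limn_einf_sup vE).1; apply: limn_einf_le.
(* From [2 k] on the base of the power is nonnegative, so taking powers is monotone. *)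
exists (2 * k)%N => // m /= km.
have m0 : (0 : R) < m%:R by rewrite ltr0n; lia.
have k0' : (0 : R) < k%:R by rewrite ltr0n.
pose N := (m %/ k)%N.
have NR : k%:R^-1 - 2 * harmonic m <= N%:R / m%:R :> R.
  have mk : (m%:R : R) < (N%:R + 1) * k%:R.
    by rewrite natr1 -natrM ltr_nat -ltn_divLR.
  apply: (@le_trans _ _ (k%:R^-1 - m%:R^-1)).
    rewrite lerD2l lerN2 /harmonic /= -[leLHS]mul1r ler_pdivrMr// mulrAC.
    rewrite ler_pdivlMr// mul1r -natr1.
    have : (1 : R) <= m%:R by rewrite ler1n; lia.
    lra.
  rewrite ler_pdivlMr// mulrBl mulVf ?gt_eqF// lerBlDr mulrC ler_pdivrMr//.
  exact: ltW.
have h0 : 0 <= k%:R^-1 - 2 * harmonic m :> R.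
  rewrite subr_ge0 /harmonic /= -[leRHS]mul1r ler_pdivlMr// mulrAC ler_pdivrMr// mul1r.
  by rewrite -natrM ler_nat; lia.
apply: (@le_trans _ _ (((c * N ^ d)%:R : R)%:E * ((m%:R ^+ d)^-1)%:E)%E).
  rewrite -EFinM lee_fin natrM natrX /v -mulrA -exprVn -exprMn.
  by rewrite ler_wpM2l// lerXn2r// nnegrE (le_trans h0).
rewrite lee_wpmul2r// ?lee_fin ?invr_ge0 ?exprn_ge0//.
by apply: uN; rewrite mulnC leq_trunc_div.
Qed.

End Counting.

Theorem corollary3 (R : realType) (r d : nat) (hr : (1 <= r)%N)
    (hd : (2 <= d)%N) :
  ((4 / (2 ^+ d.+1 + d%:R - 2) ^+ d.+1)%:E
     <= limn_einf (fun m : nat =>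
          max_num_tori R r d m * ((m%:R ^+ d.+1)^-1)%:E))%E.
Proof.
have [d2|d3] := eqVneq d 2%N.
  (* [2 / 6^3 = 1 / 108] exceeds [4 / 8^3 = 1 / 128]. *)
  rewrite {}d2 {d hd}; apply: (@le_trans _ _ ((2%:R / 6%:R ^+ 3 : R)%:E)).
    have -> : 2 ^+ 3 + 2%:R - 2 = 8 :> R by rewrite !exprS expr0; lra.
    rewrite lee_fin ler_pdivrMr ?exprn_gt0// mulrAC ler_pdivlMr ?exprn_gt0//.
    by rewrite !exprS expr0; lra.
  apply: limn_einf_power_growth => // N m Nm.
  apply: max_num_tori_ge Nm _ => a e a0 e0 eS ea.
  exists (rotating_field (tower_degrees 2 N 2) e).
    by move=> j; exact: polyfun_rotating_field.
  move=> psi w psiP.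
  by apply: (@rotating_torus R N (tower_degrees 2 N 2) e _ _ _ a psi w).
have {hd d3} hd : (2 < d)%N by rewrite ltn_neqAle eq_sym d3.
(* The summand [d - 2] is nonnegative, so dropping it from the denominator only increases the
   constant. *)
apply: (@le_trans _ _ ((4%:R / (2 ^ d.+1)%:R ^+ d.+1 : R)%:E)).
  have d0 : (2 : R) <= d%:R by rewrite ler_nat ltnW.
  have p0 : (0 : R) < 2 ^+ d.+1 by rewrite exprn_gt0.
  rewrite lee_fin natrX ler_wpM2l// lef_pV2 ?posrE ?exprn_gt0//; last by lra.
  by rewrite lerXn2r// ?nnegrE; lra.
apply: limn_einf_power_growth => [|N m Nm]; first by rewrite expn_gt0.
apply: max_num_tori_ge Nm _ => a e a0 e0 eS ea.
pose nn := tower_degrees d N 4.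
have nn0 : (nn 0 <= N)%N by rewrite /nn /tower_degrees (ltn_trans _ hd).
have nnS i : (i < d)%N -> (nn i.+1 <= 2 ^ i * N)%N.
  move=> id; rewrite /nn /tower_degrees; case: ltnP => di.
    by rewrite leq_pmull// expn_gt0.
  (* Here [i = d - 1 >= 2], so [4 <= 2 ^ i]: the last factor may have [4 N] roots because
     [d >= 3]. *)
  by rewrite leq_mul2r (@leq_pexp2l 2 2 i)// ?orbT//; lia.
exists (@gradient_field R d nn e); first by move=> j; exact: polyfun_gradient_field.
move=> psi w psiP; apply: (gradient_torus _ nn0 nnS e0 eS ea a0) => j jd y ya.
have [h1 h2 h3] := psiP j jd y ya; split=> //.
by apply/eqP => p'0; move: h2; rewrite p'0 mul0r ltxx.
Qed.
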